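(* Let $\tau\in[0,\infty)$ and let $(X,f)$ be a dynamical system satisfying the non-uniform $\tau$-specification property. Let $K,L$ be two (disjoint) non-empty closed sets in $\mathcal{M}_f(X)$ and $\{p_0,p_1\}$ a distal pair of $X$ satisfying the following conditions: (1) $K$ can be written as a union $K=\bigcup_{i\in I}K_i$, where each $K_i$ is a non-empty connected closed set with $G_{K_i}\neq\varnothing$; (2) for any $\mu\in\overline{\mathrm{co}}(K\cup V_f(p_0)\cup V_f(p_1))$ and any $\nu\in L$, one has $\rho_{\mathsf{tv}}(\mu,\nu)>\frac{\tau}{1+\tau}$. Then for any non-empty open set $U\subset X$, there exists an uncountable DC1-scrambled set contained in $$G^K\cap U\cap\mathrm{Trans}(f)\setminus\bigcup_{\nu\in L}G^{\nu}.$$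
   Context: A dynamical system $(X,f)$ consists of a compact metric space $(X,d)$ with at least two points and a continuous map $f:X\to X$. $\mathbb{N}$ denotes the positive integers. $\mathcal{M}(X)$ and $\mathcal{M}_f(X)$ are the spaces of Borel probability measures and of $f$-invariant Borel probability measures on $X$, with the weak* topology; $\mathfrak{B}(X)$ is the Borel $\sigma$-algebra. $\overline{\mathrm{co}}$ denotes the (weak* ) closed convex hull. Non-uniform specification property: $(X,f)$ satisfies the non-uniform specification property with gap function $M(n,\varepsilon):\mathbb{N}\times(0,+\infty)\to\mathbb{N}$ if (i) $M(n,\varepsilon)$ is non-decreasing in $n$ and non-increasing in $\varepsilon$; (ii) for every $\varepsilon>0$, any integer $k\ge2$, any $x_1,\dots,x_k\in X$ and any non-negative integers $a_1\le b_1<a_2\le b_2<\cdots<a_k\le b_k$ with $a_{i+1}-b_i\ge M(b_i-a_i+1,\varepsilon)$ for $1\le i\le k-1$, there exists $z\in X$ such that $d(f^{n-a_i}x_i,f^nz)\le\varepsilon$ for all $a_i\le n\le b_i$ and $1\le i\le k$. Non-uniform $\tau$-specification property: let $\mathscr{G}(X,f)$ be the collection of all gap functions for which $(X,f)$ satisfies the non-uniform specification property, and for $M\in\mathscr{G}(X,f)$ let $\tau(M)=\sup_{\varepsilon>0}\liminf_{n\to\infty}\frac{M(n,\varepsilon)}{n}$. $(X,f)$ satisfies the non-uniform $\tau$-specification property if there is $M\in\mathscr{G}(X,f)$ with $\tau(M)=\tau$ and every $M'\in\mathscr{G}(X,f)$ satisfies $\tau(M')\ge\tau$. For $x\in X$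 and $n\in\mathbb{N}$ let $\delta_x^n=\frac1n\sum_{k=0}^{n-1}\delta_{f^kx}$, and let $V_f(x)$ be the set of weak* accumulation points of $\{\delta_x^n\}_{n\ge1}$. For non-empty $K\subset\mathcal{M}_f(X)$, $G^K=\{x\in X:V_f(x)\supset K\}$, and $G^\nu=G^{\{\nu\}}$. For non-empty compact connected $K\subset\mathcal{M}_f(X)$, $G_K=\{x\in X:V_f(x)=K\}$. $\mathrm{Trans}(f)=\{x\in X:\omega(x,f)=X\}$, where $\omega(x,f)$ is the $\omega$-limit set of $x$. The total variation distance on $\mathcal{M}(X)$ is $\rho_{\mathsf{tv}}(\mu,\nu)=\sup_{B\in\mathfrak{B}(X)}|\mu(B)-\nu(B)|$. A pair $\{p_0,p_1\}\subset X$ is distal if $\inf_{n\ge0}d(f^np_0,f^np_1)>0$. A pair $\{x,y\}$ is DC1-scrambled if for every $t>0$, $\limsup_{n\to\infty}\frac1n|\{j\in[0,n-1]:d(f^jx,f^jy)<t\}|=1$, and there exists $t_0>0$ such that $\liminf_{n\to\infty}\frac1n|\{j\in[0,n-1]:d(f^jx,f^jy)<t_0\}|=0$ (here $j$ ranges over integers). A set $S\subset X$ is DC1-scrambled if each pair of distinct points of $S$ is DC1-scrambled. *)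

(* Defs.v *)
From HB Require Import structures.
From mathcomp Require Import all_boot all_order all_algebra.
From mathcomp Require Import all_classical all_reals all_analysis.

Set Implicit Arguments.
Unset Strict Implicit.
Unset Printing Implicit Defensive.

Import Order.TTheory GRing.Theory Num.Theory.
Import numFieldNormedType.Exports.

Local Open Scope classical_set_scope.
Local Open Scope ring_scope.

(* The library's measurable spaces are pointed, so the base point is needed to
   form the Borel sigma-algebra; nothing else depends on it. *)
#[short(type="pmetricType")]
HB.structure Definition PointedMetric (R : numDomainType) :=
  { M of Metric R M & Pointed M }.

Section BorelProbabilities.
Context {R : realType} (X : pmetricType R).

Definition borel : Type := g_sigma_algebraType (@open X).
HB.instance Definition _ := Measurable.on borel.

Definition borel_prob : Type := probability borel R.
HB.instance Definition _ := Choice.on borel_prob.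

Definition integral_pairing (mu : borel_prob) :
    {ptws continuousType X R -> R} :=
  fun g => \int[mu]_(x in [set: borel]) g x.

(* Weak* topology: the coarsest one making mu |-> \int g dmu continuous for
   every continuous g.  A [probability] is a function on all subsets, of which
   only the values on Borel sets matter; probabilities that agree on the Borel
   sets cannot be separated by this topology, so that (relatively) closed sets,
   closures and sets of accumulation points are stable under this
   identification. *)
HB.instance Definition _ :=
  Topological.copy borel_prob (initial_topology integral_pairing).

End BorelProbabilities.

Section Measures.
Context {R : realType} {X : pmetricType R}.
Implicit Types (mu nu : borel_prob X) (A K : set (borel_prob X)).

Definition invariant_prob (f : X -> X) : set (borel_prob X) :=
  [set mu | forall B : set (borel X), measurable B -> mu (f @^-1` B) = mu B].

Definition closed_in_invariant (f : X -> X) K : Prop :=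
  K `<=` invariant_prob f /\ closed (K : set (subspace (invariant_prob f))).

Definition convex_hull A : set (borel_prob X) :=
  [set mu | exists (n : nat) (w : 'I_n -> R) (m : 'I_n -> borel_prob X),
    [/\ forall i, 0 <= w i, \sum_i w i = 1, forall i, A (m i) &
        forall B : set (borel X), measurable B ->
          mu B = (\sum_i (w i)%:E * m i B)%E]].

Definition closed_convex_hull A : set (borel_prob X) := closure (convex_hull A).

Definition tv_dist mu nu : \bar R :=
  ereal_sup [set `|mu B - nu B|%E | B in @measurable _ (borel X)].

End Measures.

Section Empirical.
Context {R : realType} {X : pmetricType R}.
Variables (f : X -> X) (x : X).

(* Shifted index: this is delta_x^(n+1), so that every n : nat is allowed. *)
Definition empirical (n : nat) : set (borel X) -> \bar R :=
  mscale (n.+1%:R^-1)%:nng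
    (msum (fun k => dirac (iter k f x : borel X)) n.+1).

HB.instance Definition _ n := Measure.on (empirical n).

Let empirical_setT n : empirical n [set: borel X] = 1%E.
Proof.
rewrite /empirical /mscale/= /msum.
rewrite (eq_bigr (fun=> 1%E)) => [|i _]; last exact: diracT.
by rewrite sumEFin -EFinM big_const_ord iter_addr_0 mulVf// pnatr_eq0.
Qed.

HB.instance Definition _ n :=
  Measure_isProbability.Build _ _ _ (empirical n) (empirical_setT n).

End Empirical.

Section Dynamics.
Context {R : realType} {X : pmetricType R}.
Implicit Types (f : X -> X) (K : set (borel_prob X)).

Definition V_ f (x : X) : set (borel_prob X) :=
  cluster ((fun n => empirical f x n : borel_prob X) @ \oo).

Definition Gsup f K : set X := [set x | K `<=` V_ f x].

Definition Geq f K : set X := [set x | V_ f x = K].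

Definition omega_limit f (x : X) : set X := cluster ((fun n => iter n f x) @ \oo).

Definition Trans f : set X := [set x | omega_limit f x = setT].

Definition distal_pair f (p0 p1 : X) : Prop :=
  0 < inf (range (fun n => mdist (iter n f p0) (iter n f p1))).

Definition close_freq f (x y : X) (t : R) (n : nat) : \bar R :=
  (#|[set j : 'I_n | mdist (iter j f x) (iter j f y) < t]%SET|%:R / n%:R)%:E.

Definition DC1_pair f (x y : X) : Prop :=
  (forall t : R, 0 < t -> limn_esup (close_freq f x y t) = 1%E) /\
  (exists2 t0 : R, 0 < t0 & limn_einf (close_freq f x y t0) = 0%E).

Definition DC1_scrambled f (S : set X) : Prop :=
  forall x y, S x -> S y -> x <> y -> DC1_pair f x y.

(* Gap functions are only meaningful on (positive integers) x (0, +oo): their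
   values at n = 0 or eps <= 0 are never constrained nor used. *)
Definition gap_function (M : nat -> R -> nat) : Prop :=
  [/\ forall n eps, (0 < n)%N -> 0 < eps -> (0 < M n eps)%N,
      forall m n eps, (0 < m)%N -> (m <= n)%N -> 0 < eps ->
        (M m eps <= M n eps)%N &
      forall n eps1 eps2, (0 < n)%N -> 0 < eps1 -> eps1 <= eps2 ->
        (M n eps2 <= M n eps1)%N].

(* Only the first k terms of the sequences x, a and b are used.  The
   subtractions on nat are not truncated: a i <= b i < a i.+1 and a i <= n. *)
Definition non_uniform_specification f (M : nat -> R -> nat) : Prop :=
  gap_function M /\
  forall (eps : R) (k : nat) (x : nat -> X) (a b : nat -> nat),
    0 < eps -> (2 <= k)%N ->
    (forall i, (i < k)%N -> (a i <= b i)%N) ->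
    (forall i, (i.+1 < k)%N -> (b i < a i.+1)%N) ->
    (forall i, (i.+1 < k)%N -> (M (b i - a i).+1 eps <= a i.+1 - b i)%N) ->
    exists z : X, forall i n, (i < k)%N -> (a i <= n <= b i)%N ->
      mdist (iter (n - a i) f (x i)) (iter n f z) <= eps.

Definition gap_rate (M : nat -> R -> nat) : \bar R :=
  ereal_sup [set limn_einf (fun n => ((M n eps)%:R / n%:R)%:E)
            | eps in [set eps : R | 0 < eps]].

Definition non_uniform_tau_specification f (tau : R) : Prop :=
  (exists2 M, non_uniform_specification f M & gap_rate M = tau%:E) /\
  (forall M, non_uniform_specification f M -> (tau%:E <= gap_rate M)%E).

End Dynamics.

(* Main.v *)
Require Import Defs.
From HB Require Import structures.
From mathcomp Require Import all_boot all_order all_algebra.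
From mathcomp Require Import all_classical all_reals all_analysis.
From mathcomp Require Import measurable_realfun.
From mathcomp Require Import lra ring zify.

Set Implicit Arguments.
Unset Strict Implicit.
Unset Printing Implicit Defensive.

Import Order.TTheory GRing.Theory Num.Theory.
Import numFieldNormedType.Exports.

Local Open Scope classical_set_scope.
Local Open Scope ring_scope.

(* Empirical measures of a point depend on long time intervals only.  A point z
   is built as a limit of points z_k, where z_k.+1 shadows z_k up to time t k, a
   point of a dense sequence for one instant, and then a target x k up to a time
   t k.+1 that is much longer than everything before it.  All this is one
   application of specification, so the uncontrolled gap costs only the gap of
   the segment [0, t k] up to a constant; the lower limit in the definition of
   tau lets t k be chosen so that this gap is about tau * t k.  The targets at
   even k have V_f inside K and run through a dense family of measures of K; at
   odd k the target is p0 or p1 according to a bit of a 0-1 sequence, every bit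
   being used infinitely often.  Even blocks make two such points close with
   upper frequency 1, odd blocks make them apart with upper frequency 1 when the
   sequences differ.  Any limit nu of the empirical measures of z is a mixture
   of a gap part of weight at most tau / (1 + tau) and of a measure mu in the
   closed convex hull, so that nu is within tau / (1 + tau) of mu in total
   variation and is not in L.  Passing to limits requires compactness of the
   space of probabilities, hence the Riesz representation theorem. *)

(** * Integrals of continuous functions and weak* convergence *)

Section ContinuousIntegrals.
Context {R : realType} {X : pmetricType R}.
Hypothesis X_compact : compact [set: X].
Implicit Types (g h : X -> R) (mu : borel_prob X).

Definition mean mu g : R := \int[mu]_(x in [set: borel X]) g x.

Lemma open_borel (U : set X) : open U -> measurable (U : set (borel X)).
Proof. by move=> oU; exact: sub_gen_smallest. Qed.

Lemma continuous_borel g : continuous g ->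
  measurable_fun [set: borel X] (g : borel X -> R).
Proof.
move=> cg; apply: (measurability _ (RGenOInfty.measurableE R)) => //.
move=> _ [_ [a ->] <-]; rewrite setTI; apply: open_borel.
by move/continuousP : cg => /(_ `]a, +oo[%classic); apply; exact: interval_open.
Qed.

Lemma continuous_bounded g : continuous g ->
  exists2 b : R, 0 < b & forall x, `|g x| <= b.
Proof.
move=> cg.
have /compact_bounded[b [_ bP]] : compact (g @` [set: X]).
  by apply: continuous_compact => //; exact: continuous_subspaceT.
exists (`|b| + 1); first by rewrite ltr_wpDl.
move=> x; apply: bP; last by exists x.
by rewrite (le_lt_trans (ler_norm b))// ltrDl.
Qed.

Lemma continuous_integrable mu g : continuous g ->
  mu.-integrable [set: borel X] (EFin \o g).
Proof.
move=> cg; apply: measurable_bounded_integrable => //.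
- by rewrite [X in (X < _)%E](_ : _ = 1%E) ?ltry//; exact: (@probability_setT _ _ _ mu).
- exact: continuous_borel.
- have [b b0 gb] := continuous_bounded cg.
  exists b; split; first by rewrite gtr0_real.
  by move=> y by_ x _ /=; rewrite (le_trans (gb x))// ltW.
Qed.

Lemma meanD mu g h : continuous g -> continuous h ->
  mean mu (fun x => g x + h x) = mean mu g + mean mu h.
Proof. by move=> cg ch; rewrite /mean RintegralD//; exact: continuous_integrable. Qed.

Lemma meanZ mu a g : continuous g -> mean mu (fun x => a * g x) = a * mean mu g.
Proof. by move=> cg; rewrite /mean RintegralZl//; exact: continuous_integrable. Qed.

Lemma mean_le mu g h : continuous g -> continuous h ->
  (forall x, g x <= h x) -> mean mu g <= mean mu h.
Proof.
by move=> cg ch gh; apply: le_Rintegral => //; exact: continuous_integrable.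
Qed.

Lemma mean_cst mu a : mean mu (fun=> a) = a.
Proof.
rewrite /mean Rintegral_cst// [X in fine X](_ : _ = 1%E) ?mulr1//.
exact: (@probability_setT _ _ _ mu).
Qed.

Lemma mean_dist mu g h (e : R) : continuous g -> continuous h ->
  (forall x, `|g x - h x| <= e) -> `|mean mu g - mean mu h| <= e.
Proof.
move=> cg ch gh.
have ce : continuous (fun _ : X => e) by move=> x; exact: cvg_cst.
have H g' h' : continuous g' -> continuous h' -> (forall x, `|g' x - h' x| <= e) ->
    mean mu g' - mean mu h' <= e.
  move=> cg' ch' gh'; rewrite lerBlDl -[X in _ + X](mean_cst mu e) -meanD//.
  apply: mean_le => //; first by move=> x; apply: cvgD; [exact: ch'|exact: cvg_cst].
  by move=> x; rewrite -lerBlDl (le_trans (ler_norm _)).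
rewrite ler_norml H// andbT lerNl opprB H// => x.
by rewrite distrC.
Qed.

End ContinuousIntegrals.

(** The topology is initial for a map into a product indexed by continuous functions, so convergence
    can be tested one coordinate at a time. Unbundled functions [g] spare the later proofs the
    packed type. *)
Lemma weak_cvgP {R : realType} {X : pmetricType R} (F : set_system (borel_prob X))
    (mu : borel_prob X) : Filter F ->
  (F --> mu) <-> (forall g : X -> R, continuous g ->
    (fun nu => mean nu g) @ F --> mean mu g).
Proof.
move=> FF; split.
  move=> Fmu g cg.
  have /= H : continuous (@integral_pairing R X : borel_prob X -> _).
    exact: (@initial_continuous _ _ (@integral_pairing R X)).
  have Fp : (@integral_pairing R X) @ F --> integral_pairing mu.
    exact: (cvg_trans (cvg_app _ Fmu) (H mu)).
  have Hg := @proj_continuous (continuousType X R) (fun=> R) (mkcts cg) (integral_pairing mu).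
  exact: (cvg_trans (cvg_app _ Fp) Hg).
move=> H A [_ [[B oB <-] Bmu BA]]; rewrite nbhs_filterE.
suff Fp : (@integral_pairing R X) @ F --> integral_pairing mu.
  by apply: (filterS BA); apply: Fp; exact: open_nbhs_nbhs.
apply/cvg_sup => g; apply/cvg_image.
  by rewrite eqEsubset; split=> v // _; exists (cst v).
apply: cvg_trans (H g (@cts_fun _ _ g)) => W FW.
exists (@^~ g @^-1` W) => //.
by rewrite eqEsubset; split => [j [? + <-//]|j Wj]; exists (fun=> j).
Qed.

(** * Continuous approximations of open sets *)

Section ContinuousRealFunctions.
Context {R : realType} {T : topologicalType}.
Implicit Types (g h : T -> R).

Lemma cont_cst (a : R) : continuous (fun _ : T => a).
Proof. by move=> x; exact: cvg_cst. Qed.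

Lemma cont_add g h : continuous g -> continuous h -> continuous (fun x => g x + h x).
Proof. by move=> cg ch x; apply: cvgD; [exact: cg|exact: ch]. Qed.

Lemma cont_mul g h : continuous g -> continuous h -> continuous (fun x => g x * h x).
Proof. by move=> cg ch x; apply: cvgM; [exact: cg|exact: ch]. Qed.

Lemma cont_min g h : continuous g -> continuous h ->
  continuous (fun x => Num.min (g x) (h x)).
Proof.
by move=> cg ch x; exact: (@continuous_min R T g h x (cg x) (ch x)).
Qed.

Lemma cont_max g h : continuous g -> continuous h ->
  continuous (fun x => Num.max (g x) (h x)).
Proof.
by move=> cg ch x; exact: (@continuous_max R T g h x (cg x) (ch x)).
Qed.

Lemma cont_sum (n : nat) (G : nat -> T -> R) : (forall i, continuous (G i)) ->
  continuous (fun x => \sum_(i < n) G i x).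
Proof.
move=> cG; elim: n => [|n IHn].
  by under eq_fun do rewrite big_ord0; exact: cont_cst.
by under eq_fun do rewrite big_ord_recr/=; exact: cont_add.
Qed.

End ContinuousRealFunctions.

Section DistanceToComplement.
Context {R : realType} {X : pmetricType R}.
Implicit Types (U : set X) (g h : X -> R).

Lemma nbhs_mdist (x : X) (A : set X) :
  nbhs x A <-> exists2 e : R, 0 < e & forall y, mdist x y < e -> A y.
Proof.
by rewrite -(metricType_numDomainType.filter_from_mdist_nbhs x);
  split=> -[e e0 eA]; exists e.
Qed.

Lemma lipschitz_continuous g (k : R) : 0 <= k ->
  (forall x y, `|g x - g y| <= k * mdist x y) -> continuous g.
Proof.
move=> k0 gk x; apply/cvgrPdist_lt => e e0.
apply/nbhs_mdist; exists (e / (k + 1)).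
  by rewrite divr_gt0// ltr_wpDl.
move=> y; rewrite ltr_pdivlMr ?ltr_wpDl// => xye.
rewrite (le_lt_trans (gk x y))// (le_lt_trans _ xye)// mulrC.
by rewrite ler_wpM2l ?mdist_ge0// lerDl.
Qed.

(** Distance to the complement of [U], truncated at 1; the element 1 keeps the infimum meaningful
    when [U] is the whole space. *)
Definition dcompl U (x : X) : R := inf ([set 1] `|` [set mdist x y | y in ~` U]).

Let has_inf_dcompl U x : has_inf ([set 1] `|` [set mdist x y | y in ~` U] : set R).
Proof.
split; first by exists 1; left.
by exists 0 => _ [->|[y _ <-]]//; exact: mdist_ge0.
Qed.

Lemma dcompl_ge0 U x : 0 <= dcompl U x.
Proof.
apply: lb_le_inf; first by exists 1; left.
by move=> _ [->|[y _ <-]]//; exact: mdist_ge0.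
Qed.

Lemma dcompl_out U x : ~ U x -> dcompl U x = 0.
Proof.
move=> Ux; apply/eqP; rewrite eq_le dcompl_ge0 andbT.
apply: ge_inf; first by have [] := has_inf_dcompl U x.
by right; exists x => //; rewrite mdistxx.
Qed.

Lemma dcompl_gt0 U x : open U -> U x -> 0 < dcompl U x.
Proof.
move=> oU Ux; have /nbhs_mdist[e e0 eU] : nbhs x U by exact: open_nbhs_nbhs.
apply: (@lt_le_trans _ _ (Num.min 1 e)); first by rewrite lt_min ltr01.
apply: lb_le_inf; first by exists 1; left.
move=> _ [->|[y Uy <-]]; first by rewrite ge_min lexx.
by rewrite ge_min; apply/orP; right; rewrite leNgt; apply/negP => /eU.
Qed.

Lemma dcompl_lip U x y : `|dcompl U x - dcompl U y| <= mdist x y.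
Proof.
have H u v : dcompl U u - mdist u v <= dcompl U v.
  apply: lb_le_inf; first by exists 1; left.
  move=> _ [->|[w Uw <-]].
    rewrite lerBlDr (@le_trans _ _ 1)// ?lerDl ?mdist_ge0//.
    by apply: ge_inf; [have [] := has_inf_dcompl U u|left].
  rewrite lerBlDr (@le_trans _ _ (mdist u w))//.
    by apply: ge_inf; [have [] := has_inf_dcompl U u|right; exists w].
  by rewrite addrC metric_triangle.
rewrite ler_norml lerBlDl -lerBlDr H andbT lerNl opprB lerBlDl -lerBlDr.
by rewrite metric_sym H.
Qed.

Lemma dcompl_continuous U : continuous (dcompl U).
Proof.
apply: (@lipschitz_continuous _ 1) => // x y.
by rewrite mul1r dcompl_lip.
Qed.

Definition bump U (n : nat) (x : X) : R := Num.min 1 (n%:R * dcompl U x).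

Lemma bump_continuous U n : continuous (bump U n).
Proof.
apply: cont_min; first exact: cont_cst.
by apply: cont_mul; [exact: cont_cst|exact: dcompl_continuous].
Qed.

Lemma bump_ge0 U n x : 0 <= bump U n x.
Proof. by rewrite le_min ler01 mulr_ge0// dcompl_ge0. Qed.

Lemma bump_le1 U n x : bump U n x <= 1.
Proof. by rewrite ge_min lexx. Qed.

Lemma bump_out U n x : ~ U x -> bump U n x = 0.
Proof. by move=> Ux; rewrite /bump dcompl_out// mulr0 minElt ltr10. Qed.

End DistanceToComplement.

(** * Riesz representation *)

Section Riesz.
Context {R : realType} {X : pmetricType R}.
Hypothesis X_compact : compact [set: X].

(* A finite sum of these bumps is at least 1 where g is at least e; this makes
   the outer measure below subadditive without a partition of unity. *)
Lemma bump_cover (U : nat -> set X) (g : X -> R) (e : R) : continuous g ->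
  (forall i, open (U i)) -> (forall x, e <= g x -> exists i, U i x) ->
  exists n, forall x, e <= g x -> exists2 i, (i < n)%N & bump (U i) n x = 1.
Proof.
move=> cg oU gU.
pose P n x := e <= g x -> exists2 i, (i < n)%N & bump (U i) n x = 1.
have /compact_near_coveringP/(_ nat \oo P _) H := X_compact.
have [|n _ nP] := H _; last first.
  by exists n => x; apply: (nP n) => //=.
(* Near a point where [g < e] the condition is void. Elsewhere some [dcompl (U i)] stays above half
   its value at [x], which determines how large [n] must be. *)
move=> x _; have [gxe|egx] := ltP (g x) e.
  have [d d0 dP] : exists2 d : R, 0 < d & forall y, mdist x y < d -> g y < e.
    by apply/nbhs_mdist; exact: (cg x [set y | y < e] (lt_nbhsl gxe)).
  exists ([set y | mdist x y < d], setT).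
    by split; [apply/nbhs_mdist; exists d|exact: filterT].
  by move=> [y n] [/= /dP + _]; rewrite /P leNgt => ->.
have [i Ui] := gU _ egx.
have d0 := dcompl_gt0 (oU i) Ui.
have [d d1 dP] : exists2 d : R, 0 < d &
    forall y, mdist x y < d -> dcompl (U i) x / 2 < dcompl (U i) y.
  apply/nbhs_mdist.
  apply: (dcompl_continuous (U := U i) (x := x) (lt_nbhsr _)).
  by rewrite ltr_pdivrMr// ltr_pMr// ltr1n.
pose N := (maxn i.+1 (Num.truncn (dcompl (U i) x / 2)^-1).+1).
exists ([set y | mdist x y < d], [set n | (N <= n)%N]).
  by split; [apply/nbhs_mdist; exists d|exists N].
move=> [y n] [/= /dP dy Nn] _; exists i.
  by rewrite (leq_trans _ Nn)// leq_maxl.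
apply/eqP; rewrite /bump eq_minl//.
have h0 : 0 < dcompl (U i) x / 2 by rewrite divr_gt0.
rewrite -ler_pdivrMr ?(lt_trans h0 dy)// div1r.
apply: (@le_trans _ _ (dcompl (U i) x / 2)^-1).
  by rewrite lef_pV2 ?posrE//; [exact: ltW|exact: lt_trans dy].
rewrite ltW// (lt_le_trans (truncnS_gt _))// ler_nat (leq_trans _ Nn)//.
exact: leq_maxr.
Qed.

Variable L : (X -> R) -> R.
Hypothesis LD : forall g h : X -> R, continuous g -> continuous h ->
  L (fun x => g x + h x) = L g + L h.
Hypothesis LZ : forall (a : R) (g : X -> R), continuous g -> L (fun x => a * g x) = a * L g.
Hypothesis L_le : forall g h : X -> R, continuous g -> continuous h ->
  (forall x, g x <= h x) -> L g <= L h.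
Hypothesis L_1 : L (fun=> 1) = 1.

Let L_cst a : L (fun=> a) = a.
Proof.
rewrite -[RHS]mulr1 -L_1 -LZ; last exact: cont_cst.
by congr L; apply/funext => x; rewrite mulr1.
Qed.

Let L_sum n (G : nat -> X -> R) : (forall i, continuous (G i)) ->
  L (fun x => \sum_(i < n) G i x) = \sum_(i < n) L (G i).
Proof.
move=> cG; elim: n => [|n IHn].
  by under eq_fun do rewrite big_ord0; rewrite big_ord0 L_cst.
under eq_fun do rewrite big_ord_recr/=.
by rewrite LD ?IHn ?big_ord_recr//; exact: cont_sum.
Qed.

Let below (U : set X) : set (X -> R) :=
  [set g : X -> R | continuous g /\ forall x, 0 <= g x <= 1 /\ (~ U x -> g x = 0)].

(** The test functions vanish off [U] instead of having compact support in it; replacing [g] by the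
    positive part of [g - e] shows that the supremum is the same. *)
Let open_mass U : R := sup [set L g | g in below U].

Let below_bump U n : below U (bump U n).
Proof.
split; first exact: bump_continuous.
by move=> x; rewrite bump_ge0 bump_le1; split=> //; exact: bump_out.
Qed.

Let has_sup_below U : has_sup [set L g | g in below U].
Proof.
split; first by exists (L (bump U 0)), (bump U 0) => //; exact: below_bump.
exists 1 => _ [g [cg gU] <-]; rewrite -(L_cst 1); apply: L_le => //.
  exact: cont_cst.
by move=> x; have [/andP[]] := gU x.
Qed.

Let open_mass_ub U g : below U g -> L g <= open_mass U.
Proof. by move=> Ug; apply: sup_ubound; [have [] := has_sup_below U|exists g]. Qed.

Let open_mass_le U (c : R) :
  (forall g, below U g -> L g <= c) -> open_mass U <= c.
Proof.
move=> Uc; apply: ge_sup; first by have [] := has_sup_below U.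
by move=> _ [g /Uc + <-].
Qed.

Let open_mass_adherent U (e : R) : 0 < e ->
  exists2 g, below U g & open_mass U - e < L g.
Proof.
by move=> e0; have [_ [g Ug <-] ?] := sup_adherent e0 (has_sup_below U); exists g.
Qed.

Let open_massS U V : U `<=` V -> open_mass U <= open_mass V.
Proof.
move=> UV; apply: open_mass_le => g [cg gU]; apply: open_mass_ub; split => // x.
by have [? gx] := gU x; split => // Vx; apply: gx => /UV.
Qed.

Let open_mass_ge0 U : 0 <= open_mass U.
Proof.
rewrite -(L_cst 0); apply: open_mass_ub; split; first exact: cont_cst.
by move=> x; rewrite lexx ler01.
Qed.

(** By [bump_cover], [g] is at most a finite sum of bumps of the [U i] plus [e]; it remains to apply
    [L]. *)
Let open_mass_bigcup (U : nat -> set X) g (e : R) : (forall i, open (U i)) ->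
  below (\bigcup_i U i) g -> 0 < e ->
  exists n, L g <= \sum_(i < n) open_mass (U i) + e.
Proof.
move=> oU [cg gU] e0.
have [|n nP] := @bump_cover U g e cg oU.
  move=> x egx; have [//|nU] := pselect (exists i, U i x).
  have [_ g0] := gU x; move: egx; rewrite g0 ?leNgt ?e0//.
  by move=> [i _ Ui]; apply: nU; exists i.
exists n.
have cb : continuous (fun x => \sum_(i < n) bump (U i) n x).
  by apply: (@cont_sum _ _ n (fun i => bump (U i) n)) => i; exact: bump_continuous.
have ce : continuous (fun _ : X => e) by exact: cont_cst.
apply: (@le_trans _ _ (L (fun x => \sum_(i < n) bump (U i) n x + e))).
  apply: L_le => //; first exact: cont_add.
  move=> x; have s0 : 0 <= \sum_(i < n) bump (U i) n x.
    by apply: sumr_ge0 => i _; exact: bump_ge0.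
  have [/nP[i ni b1]|/ltW gxe] := leP e (g x); last by rewrite ler_wpDl.
  have [/andP[_ g1] _] := gU x.
  rewrite (le_trans g1)// ler_wpDr ?(ltW e0)// (bigD1 (Ordinal ni))//= b1 lerDl.
  by apply: sumr_ge0 => j _; exact: bump_ge0.
rewrite LD// L_cst lerD2r (@L_sum n (fun i => bump (U i) n)).
  by apply: ler_sum => i _; exact/open_mass_ub/below_bump.
by move=> i; exact: bump_continuous.
Qed.

Let outer (A : set X) : R :=
  inf [set open_mass U | U in [set U | open U /\ A `<=` U]].

Let has_inf_outer A : has_inf [set open_mass U | U in [set U | open U /\ A `<=` U]].
Proof.
split; first by exists (open_mass setT), setT => //; split=> //; exact: openT.
by exists 0 => _ [U _ <-].
Qed.

Let outer_le A U : open U -> A `<=` U -> outer A <= open_mass U.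
Proof. by move=> oU AU; apply: ge_inf; [have [] := has_inf_outer A|exists U]. Qed.

Let le_outer A B : A `<=` B -> outer A <= outer B.
Proof.
move=> AB; apply: lb_le_inf; first by have [] := has_inf_outer B.
by move=> _ [U [oU BU] <-]; apply: outer_le => //; exact: subset_trans BU.
Qed.

Let outer_ge0 A : 0 <= outer A.
Proof.
apply: lb_le_inf; first by have [] := has_inf_outer A.
by move=> _ [U _ <-].
Qed.

Let outer_adherent A (e : R) : 0 < e ->
  exists2 U, open U /\ A `<=` U & open_mass U < outer A + e.
Proof.
by move=> e0; have [_ [U UA <-] ?] := inf_adherent e0 (has_inf_outer A); exists U.
Qed.

Let outer_open U : open U -> outer U = open_mass U.
Proof.
move=> oU; apply/eqP; rewrite eq_le outer_le//=.
apply: lb_le_inf; first by have [] := has_inf_outer U.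
by move=> _ [V [oV UV] <-]; exact: open_massS.
Qed.

Let outer0 : outer set0 = 0.
Proof.
rewrite outer_open; last exact: open0.
apply/eqP; rewrite eq_le open_mass_ge0 andbT; apply: open_mass_le => g [cg g0].
rewrite -(L_cst 0); apply: L_le => //; first exact: cont_cst.
by move=> x; have [_ ->] := g0 x.
Qed.

Let sum_half (c : R) n : \sum_(i < n) c / 2 ^+ i.+1 = c - c / 2 ^+ n.
Proof.
elim: n => [|n IHn]; first by rewrite big_ord0 expr0 divr1 subrr.
rewrite big_ord_recr/= IHn exprS; field.
by rewrite expf_neq0// pnatr_eq0.
Qed.

Let outerE (A : set X) : \bar R := (outer A)%:E.

Let outer_sigma_subadditive : sigma_subadditive outerE.
Proof.
move=> F; apply/lee_addgt0Pr => e e0.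
have s0 n : (0 <= outerE (F n))%E by rewrite lee_fin.
case Es : (\sum_(i <oo) outerE (F i))%E => [s||].
(* One half of [e] is shared among the covers [U i] as a geometric series, the other half pays for
   [open_mass_bigcup]. *)
- have e20 : 0 < e / 2 by rewrite divr_gt0.
  have /choice[U UP] : forall i, exists U, [/\ open U, F i `<=` U &
      open_mass U <= outer (F i) + e / 2 / 2 ^+ i.+1].
    move=> i; have [|U [oU FU] UF] := @outer_adherent (F i) (e / 2 / 2 ^+ i.+1).
      by rewrite divr_gt0// exprn_gt0.
    by exists U; split => //; exact: ltW.
  have oU i : open (U i) by have [] := UP i.
  rewrite lee_fin (@le_trans _ _ (open_mass (\bigcup_i U i)))//.
    apply: outer_le; first exact: bigcup_open.
    by move=> x [i _ Fx]; exists i => //; have [_ FU _] := UP i; exact: FU.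
  apply: open_mass_le => g gU; have [n ng] := open_mass_bigcup oU gU e20.
  rewrite (le_trans ng)// [leRHS](_ : _ = s + e / 2 + e / 2); last by lra.
  rewrite lerD2r (@le_trans _ _ (\sum_(i < n) (outer (F i) + e / 2 / 2 ^+ i.+1)))//.
    by apply: ler_sum => i _; have [] := UP i.
  rewrite big_split/= sum_half lerD//; last by rewrite gerBl divr_ge0 ?exprn_ge0// ltW.
  rewrite -lee_fin -Es -sumEFin (le_trans _ (nneseries_lim_ge n _))//.
  by rewrite big_mkord.
- by rewrite addye// leey.
- by have := nneseries_ge0 (fun n _ _ => s0 n) (P := xpredT) (N := 0); rewrite Es.
Qed.

HB.instance Definition _ := isOuterMeasure.Build R X outerE
  (congr1 EFin outer0) (fun A => outer_ge0 A) (fun A B AB => le_outer AB)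
  outer_sigma_subadditive.

(** Take [V] around [A] and [g] below [V] and [U], both nearly optimal. Since [g] vanishes off [U],
    the rest of [A] lies in [W], where [g < e / 4]. A function [h] below [W] and the positive part
    [g'] of [g - e / 4] are never both nonzero, so [g' + h] is below [V]. The four losses of [e / 4]
    come from [V], [g], [h] and [g']. *)
Let open_caratheodory U : open U -> outerE.-caratheodory U.
Proof.
move=> oU; apply: (@le_caratheodory_measurable _ _ outerE) => A.
rewrite -EFinD lee_fin; apply/ler_addgt0Pr => e e0.
have e40 : 0 < e / 4 by rewrite divr_gt0.
have [V [oV AV] VA] := outer_adherent A e40.
have [g [cg gVU] VUg] := open_mass_adherent (V `&` U) e40.
pose W := V `&` [set x | g x < e / 4].
have oW : open W.
  by apply: openI => //; move/continuousP : cg => /(_ _ (@open_lt R (e / 4))).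
have [h [ch hW] Wh] := open_mass_adherent W e40.
pose g' x := Num.max (g x - e / 4) 0.
have cg' : continuous g'.
  by apply: cont_max; [apply: cont_add => //|]; exact: cont_cst.
have gg' : L g <= L g' + e / 4.
  rewrite -[X in _ + X]L_cst -LD//; last exact: cont_cst.
  apply: L_le => //; first by apply: cont_add => //; exact: cont_cst.
  by move=> x; rewrite -lerBlDr le_max lexx.
have g'h : L g' + L h <= open_mass V.
  rewrite -LD//; apply: open_mass_ub; split; first exact: cont_add.
  move=> x; have [/andP[g0 g1] gVU0] := gVU x; have [/andP[h0 h1] hW0] := hW x.
  have [gx|gx] := ltP (g x) (e / 4).
    have -> : g' x = 0 by apply/max_idPr; rewrite subr_le0 ltW.
    by rewrite add0r h0 h1; split => // Vx; apply: hW0 => -[].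
  have hx0 : h x = 0 by apply: hW0 => -[_ /=]; rewrite ltNge gx.
  have -> : g' x = g x - e / 4 by apply/max_idPl; rewrite subr_ge0.
  rewrite hx0 addr0 subr_ge0 gx lerBlDr (le_trans g1) ?lerDl ?(ltW e40)//.
  by split => // Vx; move: gx; rewrite gVU0 ?leNgt ?e40// => -[].
have H1 : outer (A `&` U) <= open_mass (V `&` U).
  by apply: outer_le; [exact: openI|exact: setSI].
have H2 : outer (A `&` ~` U) <= open_mass W.
  apply: outer_le => // x [Ax Ux]; split; first exact: AV.
  by have [_ /= ->] := gVU x; [|case].
lra.
Qed.

Let borel_caratheodory (B : set (borel X)) :
  measurable B -> outerE.-caratheodory (B : set X).
Proof.
(* A Borel set belongs to every sigma-algebra containing the open sets, in particular to that of the
   Caratheodory measurable sets. *)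
move=> mB; apply: (mB (outerE.-caratheodory)); split.
  exact: sigma_algebra_measurable (caratheodory_type outerE).
exact: open_caratheodory.
Qed.

Definition riesz_measure : set (borel X) -> \bar R := outerE.

Let riesz_measure0 : riesz_measure set0 = 0%E.
Proof. exact: (outer_measure0 outerE). Qed.

Let riesz_measure_ge0 B : (0 <= riesz_measure B)%E.
Proof. exact: (outer_measure_ge0 outerE). Qed.

Let riesz_measure_sigma_additive : semi_sigma_additive riesz_measure.
Proof.
move=> F mF tF mUF.
apply: (@caratheodory_measure_sigma_additive R X outerE F) => //.
  by move=> i; exact: borel_caratheodory.
exact: borel_caratheodory.
Qed.

HB.instance Definition _ := isMeasure.Build _ _ _ riesz_measure
  riesz_measure0 riesz_measure_ge0 riesz_measure_sigma_additive.

Let riesz_open (U : set X) : open U -> riesz_measure U = (open_mass U)%:E.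
Proof. by move=> oU; rewrite /riesz_measure /outerE outer_open. Qed.

Let riesz_measure_setT : riesz_measure setT = 1%E.
Proof.
rewrite riesz_open; last exact: openT.
congr EFin; apply/eqP; rewrite eq_le; apply/andP; split.
  by apply: open_mass_le => g [cg gT]; rewrite -L_1; apply: L_le => // [|x];
    [exact: cont_cst|have [/andP[]] := gT x].
rewrite -L_1; apply: open_mass_ub; split; first exact: cont_cst.
by move=> x; rewrite ler01 lexx; split => // /(_ I).
Qed.

HB.instance Definition _ :=
  Measure_isProbability.Build _ _ _ riesz_measure riesz_measure_setT.

Let P : borel_prob X := riesz_measure.

(** Both sides are compared with the mass of the open set where [a > 0]: [a] is one of its test
    functions and [b] dominates its indicator. *)
Let riesz_indic_le (a b : X -> R) : continuous a -> continuous b ->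
  (forall x, 0 <= a x <= 1) -> (forall x, 0 <= b x) ->
  (forall x, 0 < a x -> 1 <= b x) -> L a <= mean P b.
Proof.
move=> ca cb a01 b0 ab; pose U := [set x | 0 < a x].
have oU : open U by move/continuousP : ca => /(_ _ (@open_gt R 0)).
apply: (@le_trans _ _ (open_mass U)).
  apply: open_mass_ub; split => // x; split => // /negP; rewrite -leNgt => ax.
  by apply/eqP; rewrite eq_le ax; have /andP[] := a01 x.
have Ub := continuous_integrable X_compact P cb.
rewrite -lee_fin -(riesz_open oU) /mean /Rintegral fineK; last first.
  exact: integrable_fin_num.
rewrite [leLHS](_ : _ = \int[P]_(x in [set: borel X]) (\1_U x)%:E)%E; last first.
  by rewrite integral_indic ?setIT//; exact: open_borel.
apply: ge0_le_integral => //=.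
- by apply/measurable_EFinP; apply: measurable_indic; exact: open_borel.
- by apply/measurable_EFinP; exact: continuous_borel.
- move=> x _; rewrite lee_fin indicE.
  by case: (boolP (x \in (U : set X))) => [/set_mem/ab//|_]; exact: b0.
Qed.

Let sum_min (t : R) n : 0 <= t ->
  \sum_(i < n) Num.min (Num.max (t - i%:R) 0) 1 = Num.min t n%:R.
Proof.
move=> t0; elim: n => [|n IHn]; first by rewrite big_ord0 (min_idPr _).
rewrite big_ord_recr/= IHn -natr1.
case: (leP t n%:R) => tn.
  rewrite (max_idPr _) ?subr_le0// (min_idPl ler01) addr0.
  by rewrite (min_idPl _)// (le_trans tn)// lerDl.
rewrite (max_idPl _) ?subr_ge0 1?ltW//.
case: (leP (t - n%:R) 1) => tn1.
  by rewrite (min_idPl _)//; lra.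
by rewrite (min_idPr _)//; lra.
Qed.

Let mean_sum n (G : nat -> X -> R) : (forall i, continuous (G i)) ->
  mean P (fun x => \sum_(i < n) G i x) = \sum_(i < n) mean P (G i).
Proof.
move=> cG; elim: n => [|n IHn].
  by under eq_fun do rewrite big_ord0; rewrite big_ord0 mean_cst.
under eq_fun do rewrite big_ord_recr/=.
by rewrite meanD ?IHn ?big_ord_recr//; exact: cont_sum.
Qed.

(** Layer cake: [n * g] is the sum of the slices [G i], and [G i.+1] is positive only where [G i]
    equals 1, so [riesz_indic_le] bounds [L (G i.+1)] by the integral of [G i]. The shift of index
    leaves over [L (G 0) <= 1], which becomes small after division by [n]. *)
Let riesz_le (g : X -> R) : continuous g -> (forall x, 0 <= g x <= 1) -> L g <= mean P g.
Proof.
move=> cg g01; apply/ler_addgt0Pr => e e0.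
pose n := (Num.truncn e^-1).+1.
have n0 : 0 < n%:R :> R by rewrite ltr0n.
pose G i x := Num.min (Num.max (n%:R * g x - i%:R) 0) 1.
have cG i : continuous (G i).
  apply: cont_min; last exact: cont_cst.
  apply: cont_max; last exact: cont_cst.
  by apply: cont_add; [apply: cont_mul => //|]; exact: cont_cst.
have G01 i x : 0 <= G i x <= 1.
  by rewrite le_min ler01 le_max lexx orbT/= ge_min lexx orbT.
have Gg : (fun x => \sum_(i < n) G i x) = (fun x => n%:R * g x).
  apply/funext => x; have /andP[g0 g1] := g01 x.
  by rewrite sum_min ?mulr_ge0// ?(ltW n0)//; apply/min_idPl; rewrite ler_piMr// ltW.
have : n%:R * L g <= n%:R * mean P g + 1.
  rewrite -LZ// -meanZ// -Gg L_sum// mean_sum//.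
  rewrite [leLHS]big_ord_recl [in leRHS]big_ord_recr/= -addrA addrC lerD//; last first.
    apply: ler_sum => i _; apply: riesz_indic_le => // [x|x].
      by have /andP[] := G01 i x.
    rewrite /G /fintype.bump leq0n add1n -natr1 lt_min ltr01 andbT lt_max ltxx orbF => Hx.
    rewrite le_min lexx andbT le_max; apply/orP; left; lra.
  apply: (@le_trans _ _ 1).
    by rewrite -L_1; apply: L_le => // [|x]; [exact: cont_cst|have /andP[] := G01 0%N x].
  rewrite lerDr -(mean_cst P 0); apply: mean_le => // [|x]; first exact: cont_cst.
  by have /andP[] := G01 n.-1 x.
have ne : 1 <= n%:R * e.
  by rewrite -ler_pdivrMr// div1r ltW// truncnS_gt.
move=> H; rewrite -(ler_pM2l n0) mulrDr (le_trans H)// lerD2l//.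
Qed.

(** The inequality [riesz_le], applied to [b + g] and [b - g] rescaled into [0, 1], yields both
    bounds. *)
Lemma riesz_representation :
  exists mu : borel_prob X, forall g, continuous g -> mean mu g = L g.
Proof.
exists P => g cg; have [b b0 gb] := continuous_bounded X_compact cg.
have b20 : 0 < (2 * b)^-1 by rewrite invr_gt0 mulr_gt0.
have b2P t : 0 <= t -> t <= 2 * b -> 0 <= (2 * b)^-1 * t <= 1.
  move=> t0 tb; rewrite mulr_ge0 ?(ltW b20)//= mulrC ler_pdivrMr ?mul1r//.
  by rewrite mulr_gt0.
have cgb : continuous (fun x => g x + b) by apply: cont_add => //; exact: cont_cst.
have cbg : continuous (fun x => b + -1 * g x).
  by apply: cont_add; [|apply: cont_mul => //]; exact: cont_cst.
have H1 : L (fun x => (2 * b)^-1 * (g x + b)) <=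
    mean P (fun x => (2 * b)^-1 * (g x + b)).
  apply: riesz_le => [|x]; first by apply: cont_mul => //; exact: cont_cst.
  have := gb x; rewrite ler_norml => /andP[? ?].
  by apply: b2P; lra.
have H2 : L (fun x => (2 * b)^-1 * (b + -1 * g x)) <=
    mean P (fun x => (2 * b)^-1 * (b + -1 * g x)).
  apply: riesz_le => [|x]; first by apply: cont_mul => //; exact: cont_cst.
  have := gb x; rewrite ler_norml => /andP[? ?].
  by apply: b2P; lra.
have cc := @cont_cst R X.
have cm : continuous (fun x => -1 * g x) by apply: cont_mul.
move: H1 H2; rewrite !LZ// !meanZ// !(ler_pM2l b20) !LD// !meanD// !LZ// !meanZ//.
rewrite !L_cst !mean_cst => H1 H2; apply/eqP; rewrite eq_le; lra.
Qed.

End Riesz.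

(** * Weak* compactness *)

Section Compactness.
Context {R : realType} {X : pmetricType R}.
Hypothesis X_compact : compact [set: X].

(** Along an ultrafilter a cluster point is a limit; this stands in for the extraction of
    subsequences. *)
Lemma ultra_cvg (T : Type) (Y : topologicalType) (F : set_system T) (K : set Y)
    (u : T -> Y) : UltraFilter F -> compact K -> F (u @^-1` K) ->
  exists2 l, K l & u @ F --> l.
Proof.
move=> FU cK FK; have [l [Kl lcl]] := cK (u @ F) _ FK.
exists l => // B Bl; have [//|FB] := in_ultra_setVsetC (u @^-1` B) FU.
by have [y [By' By]] := lcl (~` B) B FB Bl.
Qed.

Lemma ultra_cvg_bounded (T : Type) (F : set_system T) (u : T -> R) (b : R) :
  UltraFilter F -> (forall t, `|u t| <= b) -> exists l : R, u @ F --> l.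
Proof.
move=> FU ub; have [|l _ ul] := @ultra_cvg T R F `[- b, b]%classic u FU (@segment_compact _ _ _).
  by apply: filterE => t /=; rewrite in_itv/= -ler_norml.
by exists l.
Qed.

Lemma mean_bounded (g : X -> R) (b : R) : continuous g ->
  (forall x, `|g x| <= b) -> forall mu, `|mean mu g| <= b.
Proof.
move=> cg gb mu; rewrite -[X in `|X|]subr0 -(mean_cst mu 0).
by apply: mean_dist => //[|x]; [exact: cont_cst|rewrite subr0].
Qed.

(** The limits of [mean nu g] along an ultrafilter form a positive normalised linear functional of
    [g], and the measure representing it is the limit of the ultrafilter. *)
Lemma borel_prob_compact : compact [set: borel_prob X].
Proof.
rewrite compact_ultra => F FU _.
have FP : ProperFilter F by exact: ultra_proper.
pose L g := lim ((fun nu => mean nu g) @ F).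
have HL g : continuous g -> (fun nu => mean nu g) @ F --> L g.
  move=> cg; have [b b0 gb] := continuous_bounded X_compact cg.
  have [l gl] := ultra_cvg_bounded FU (mean_bounded cg gb).
  by rewrite /L (cvg_lim _ gl).
have [|||| mu muL] := @riesz_representation R X X_compact L.
- move=> g h cg ch; apply: cvg_lim => //.
  under eq_fun do rewrite meanD//; apply: cvgD; exact: HL.
- move=> a g cg; apply: cvg_lim => //.
  by under eq_fun do rewrite meanZ//; apply: cvgMr; exact: HL.
- move=> g h cg ch gh.
  apply: (ler_cvg_to (HL g cg) (HL h ch)).
  by apply: nearW => nu; exact: mean_le.
- apply: cvg_lim => //; under eq_fun do rewrite mean_cst; exact: cvg_cst.
exists mu; split=> //=; apply/weak_cvgP => g cg.
by rewrite muL//; exact: HL.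
Qed.

Lemma uniformly_continuous (g : X -> R) (e : R) : continuous g -> 0 < e ->
  exists2 d : R, 0 < d & forall x y, mdist x y < d -> `|g x - g y| < e.
Proof.
move=> cg e0.
pose P n x := forall y, mdist x y < n.+1%:R^-1 -> `|g x - g y| < e.
have /compact_near_coveringP/(_ nat \oo P _) H := X_compact.
have [|n _ nP] := H _; last first.
  by exists n.+1%:R^-1; [rewrite invr_gt0|move=> x y; apply: (nP n) => //=].
move=> x _; have e20 : 0 < e / 2 by rewrite divr_gt0.
have [d d0 dP] : exists2 d : R, 0 < d & forall y, mdist x y < d -> `|g x - g y| < e / 2.
  by apply/nbhs_mdist; move/cvgrPdist_lt : (cg x); exact.
exists ([set y | mdist x y < d / 2], [set n | (Num.truncn (d / 2)^-1 <= n)%N]).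
  by split; [apply/nbhs_mdist; exists (d / 2) => //; rewrite divr_gt0|exists (Num.truncn (d / 2)^-1)].
move=> [y n] [/= xy dn] z yz.
have zd : mdist y z < d / 2.
  rewrite (lt_trans yz)// invf_plt ?posrE ?divr_gt0// (lt_le_trans (truncnS_gt _))//.
  by rewrite ler_nat.
rewrite -(subrKA (g x)) (le_lt_trans (ler_normD _ _))// (splitr e) ltrD//.
  by rewrite distrC dP// (lt_trans xy)// gtr_pMr// invf_lt1 ?ltr1n.
by rewrite dP// (splitr d) (le_lt_trans (metric_triangle x y z))// ltrD.
Qed.

Lemma dense_sequence : exists q : nat -> X,
  forall U : set X, open U -> U !=set0 -> exists i, U (q i).
Proof.
have [B /countable_injP[f fB] [oB bB]] := compact_second_countable X_compact.
pose V i := xget set0 [set V | B V /\ f V = i].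
exists (fun i => xget point (V i)) => U oU [x Ux].
have /bB[W [BW Wx] WU] : nbhs x U by exact: open_nbhs_nbhs.
exists (f W); apply: WU.
have -> : V (f W) = W.
  have [BV fV] : [set V | B V /\ f V = f W] (V (f W)) by apply: (@xgetI _ _ _ W).
  by apply: fB fV; rewrite inE.
exact: (@xgetI _ _ _ x).
Qed.

End Compactness.

(** * A countable dense family of continuous functions *)

Section CountablyManyTests.
Context {R : realType} {X : pmetricType R}.
Hypothesis X_compact : compact [set: X].

Section Envelope.
Variables (q : nat -> X) (s : nat).

Definition cone (p : nat * rat) (x : X) : R := ratr p.2 - s%:R * mdist x (q p.1).

(** For a fixed [q] all parameters are countable data, so these functions can be enumerated through
    [pickle]. *)
Definition envelope (c : nat) (l : seq (nat * rat)) (x : X) : R :=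
  foldr (fun p acc => Num.max (cone p x) acc) (- c%:R) l.

Lemma mdist_continuous (y : X) : continuous (fun x => mdist x y).
Proof.
apply: (@lipschitz_continuous _ _ _ 1) => // x z; rewrite mul1r.
rewrite ler_norml lerBlDr metric_triangle andbT lerNl opprB lerBlDr.
by rewrite (metric_sym x z) metric_triangle.
Qed.

Lemma cone_continuous p : continuous (cone p).
Proof.
rewrite /cone; under eq_fun do rewrite -mulN1r.
apply: cont_add; first exact: cont_cst.
apply: cont_mul; first exact: cont_cst.
by apply: cont_mul; [exact: cont_cst|exact: mdist_continuous].
Qed.

Lemma envelope_continuous c l : continuous (envelope c l).
Proof.
elim: l => [|p l IHl]; first exact: cont_cst.
by apply: cont_max => //; exact: cone_continuous.
Qed.

Lemma envelope_le c l (x : X) (b : R) : - c%:R <= b ->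
  (forall p, p \in l -> cone p x <= b) -> envelope c l x <= b.
Proof.
move=> cb; elim: l => [//|p l IHl] lb /=; rewrite ge_max lb ?mem_head//=.
by apply: IHl => p' p'l; apply: lb; rewrite in_cons p'l orbT.
Qed.

Lemma envelope_ge c l (x : X) p : p \in l -> cone p x <= envelope c l x.
Proof.
elim: l => [//|p' l IHl]; rewrite in_cons /= le_max => /predU1P[->|/IHl ->].
  by rewrite lexx.
by rewrite orbT.
Qed.

End Envelope.

(* A continuous g is, up to e, the upper envelope of finitely many cones of a
   common large slope lying below g + e. *)
Lemma dense_continuous : exists D : nat -> X -> R,
  (forall i, continuous (D i)) /\
  forall (g : X -> R) (e : R), continuous g -> 0 < e ->
    exists i, forall x, `|g x - D i x| <= e.
Proof.
have [q qd] := dense_sequence X_compact.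
pose idx : Type := (nat * nat * seq (nat * rat))%type.
pose E (t : idx) := envelope q t.1.1 t.1.2 t.2.
pose D n := oapp E (fun=> 0) (unpickle n : option idx).
exists D; split=> [i|g e cg e0].
  rewrite /D; case: unpickle => [t|] /=; last exact: cont_cst.
  exact: envelope_continuous.
have [b b0 gb] := continuous_bounded X_compact cg.
have [d d0 gd] := uniformly_continuous X_compact cg e0.
(* With this slope a cone of apex value at most [b] has fallen to [- b] at distance [d] from its
   centre; closer than [d], uniform continuity keeps it below [g + e]. *)
pose s := (Num.truncn (2 * b / d)).+1.
pose c := (Num.truncn b).+1.
have sb : 2 * b <= s%:R * d.
  by rewrite -ler_pdivrMr// ltW// truncnS_gt.
have cb : b <= c%:R by rewrite ltW// truncnS_gt.
pose good := [set p : nat * rat | forall x, cone q s p x <= g x + e].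
pose O p := [set x | g x - e < cone q s p x].
have oO p : good p -> open (O p).
  move=> _.
  have : continuous (fun x => cone q s p x + -1 * g x).
    apply: cont_add; first exact: cone_continuous.
    by apply: cont_mul => //; exact: cont_cst.
  move=> /continuousP/(_ _ (@open_gt R (- e))).
  by congr open; apply/seteqP; split => x /=; rewrite /O/= mulN1r; lra.
have cov : [set: X] `<=` cover good O.
  move=> x _; have e20 : 0 < e / 4 by rewrite divr_gt0.
  have [d' d'0 gd'] := uniformly_continuous X_compact cg e20.
  have s0 : 0 < s%:R :> R by rewrite ltr0n.
  pose d'' := Num.min d' (e / 4 / s%:R).
  have d''0 : 0 < d'' by rewrite lt_min d'0 divr_gt0.
  have [i /= iq] := qd _ (@open_interior _ (ball x d'')) (ex_intro _ x (nbhsx_ballx x d'' d''0)).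
  have {iq} : mdist x (q i) < d''.
    by have := interior_subset iq; rewrite ballEmdist.
  rewrite lt_min => /andP[xqd']; rewrite ltr_pdivlMr// => xqe.
  (* Three losses of [e / 4] each: the choice of [r], the variation of [g] from [x] to [q i], and
     the drop of the cone between them. The cone thus exceeds [g - e] at [x]. *)
  have [r r1 r2] : exists2 r : rat, g (q i) - e / 4 < ratr r & ratr r < g (q i).
    have [||y [/= yI [r _ ry]]] := @dense_rat R `]g (q i) - e / 4, g (q i)[%classic.
    - by exists (g (q i) - e / 8) => /=; rewrite in_itv/=; lra.
    - exact: interval_open.
    - by move: yI; rewrite -ry in_itv/= => /andP[? ?]; exists r.
  exists (i, r) => [y|] /=; rewrite /O /cone /=.
    have [yd|dy] := ltP (mdist y (q i)) d.
      have := gd _ _ yd; rewrite ltr_norml => /andP[? ?].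
      have : 0 <= s%:R * mdist y (q i) by rewrite mulr_ge0// mdist_ge0.
      lra.
    have : s%:R * d <= s%:R * mdist y (q i) by rewrite ler_pM2l.
    have := gb y; have := gb (q i); rewrite !ler_norml => /andP[? ?] /andP[? ?].
    lra.
  have := gd' _ _ xqd'; rewrite ltr_norml => /andP[? ?].
  have : s%:R * mdist x (q i) < e / 4 by rewrite mulrC.
  lra.
have [l lg lO] : finite_subset_cover good O [set: X].
  by move: X_compact; rewrite compact_cover; apply.
exists (pickle ((s, c, finmap.enum_fset l) : idx)) => x.
rewrite /D pickleK /= /E /= distrC ler_norml; apply/andP; split.
  have [p /= pl] := lO x I; rewrite /O /= => gp.
  have := @envelope_ge q s c (finmap.enum_fset l) x p pl; lra.
rewrite lerBlDr addrC; apply: envelope_le.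
  by have := gb x; rewrite ler_norml => /andP[? ?]; lra.
by move=> p pl; have := lg p pl; rewrite inE; exact.
Qed.

End CountablyManyTests.

(** * A countable neighbourhood base *)

Section WeakBalls.
Context {R : realType} {X : pmetricType R}.
Hypothesis X_compact : compact [set: X].
Variable D : nat -> X -> R.
Hypothesis D_continuous : forall i, continuous (D i).
Hypothesis D_dense : forall (g : X -> R) (e : R), continuous g -> 0 < e ->
  exists i, forall x, `|g x - D i x| <= e.
Implicit Types (mu nu : borel_prob X) (A : set (borel_prob X)).

(** One index sets both the number of tests and their precision, so that the balls shrink as [k]
    grows and form a countable base at [mu]. *)
Definition weak_ball (k : nat) mu : set (borel_prob X) :=
  [set nu | forall i, (i < k)%N -> `|mean nu (D i) - mean mu (D i)| < k.+1%:R^-1].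

Lemma weak_ballS k k' mu : (k <= k')%N -> weak_ball k' mu `<=` weak_ball k mu.
Proof.
move=> kk' nu H i ik; rewrite (lt_le_trans (H i (leq_trans ik kk')))//.
by rewrite lef_pV2 ?posrE ?ltr0n// ler_nat.
Qed.

Lemma weak_ball_nbhs k mu : nbhs mu (weak_ball k mu).
Proof.
have H i : \forall nu \near mu, `|mean nu (D i) - mean mu (D i)| < k.+1%:R^-1.
  have /weak_cvgP/(_ (D i) (@D_continuous i))/cvgrPdist_lt : nbhs mu --> mu by [].
  move=> /(_ k.+1%:R^-1); rewrite invr_gt0 ltr0n => /(_ isT).
  by apply: filterS => nu; rewrite distrC.
rewrite /weak_ball; elim: {-2}k => [|n IHn]; first exact: filterE.
apply: filterS2 IHn (H n) => nu IHn nun i; rewrite ltnS leq_eqVlt => /predU1P[->//|].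
exact: IHn.
Qed.

(** Replacing [g] by a test costs [e / 4] for each measure and the ball less than [e / 2]; the index
    is uniform in the measures. *)
Lemma weak_ball_mean (g : X -> R) (e : R) : continuous g -> 0 < e ->
  exists k, forall k' mu nu, (k <= k')%N -> weak_ball k' mu nu ->
    `|mean nu g - mean mu g| < e.
Proof.
move=> cg e0; have e40 : 0 < e / 4 by rewrite divr_gt0.
have [i gi] := D_dense cg e40.
exists (maxn i.+1 (Num.truncn (e / 2)^-1)) => k' mu nu.
rewrite geq_max => /andP[ik ek] /(_ i ik) W.
have H1 := mean_dist X_compact mu cg (@D_continuous i) gi.
have H2 := mean_dist X_compact nu cg (@D_continuous i) gi.
have H3 : k'.+1%:R^-1 < e / 2.
  rewrite invf_plt ?posrE ?divr_gt0// (lt_le_trans (truncnS_gt _))//.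
  by rewrite ler_nat.
move: H1 H2 W; rewrite !ler_norml !ltr_norml => /andP[? ?] /andP[? ?].
move: H3; set d := _^-1 => H3 /andP[? ?].
by apply/andP; split; lra.
Qed.

(** The filter generated by the balls of large index around [mu] converges to [mu] on each
    continuous function, hence in the topology. *)
Lemma weak_ball_base mu (O : set (borel_prob X)) : nbhs mu O ->
  exists k, forall k', (k <= k')%N -> weak_ball k' mu `<=` O.
Proof.
pose B k := [set nu | exists2 k', (k <= k')%N & weak_ball k' mu nu].
have FF : Filter (filter_from [set: nat] B).
  apply: filter_from_filter; first by exists 0%N.
  move=> k k' _ _; exists (maxn k k') => // nu [m]; rewrite geq_max => /andP[km k'm] mnu.
  by split; exists m.
move=> Omu; have : filter_from [set: nat] B --> mu.
  apply/weak_cvgP => g cg; apply/cvgrPdist_lt => e e0.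
  have [k kP] := weak_ball_mean cg e0.
  by exists k => // nu [k' kk' munu]; rewrite distrC; exact: kP munu.
by move=> /(_ O Omu)[k _ kO]; exists k => k' kk' nu munu; apply: kO; exists k'.
Qed.

Lemma weak_ball_triangle k k' mu mu' nu : (k.*2.+1 <= k')%N ->
  weak_ball k' mu nu -> weak_ball k' mu' nu -> weak_ball k mu mu'.
Proof.
move=> kk' H H' i ik.
have ik' : (i < k')%N by rewrite (leq_trans ik)// (leq_trans _ kk')//; lia.
rewrite -(subrKA (mean nu (D i))) (le_lt_trans (ler_normD _ _))//.
have : k'.+1%:R^-1 <= k.+1%:R^-1 / 2 :> R.
  rewrite -invfM lef_pV2 ?posrE ?mulr_gt0 ?ltr0n// -natrM ler_nat; lia.
have := H i ik'; have := H' i ik'; rewrite (distrC (mean mu' _)).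
move: (k'.+1%:R^-1) (k.+1%:R^-1) => c d *; lra.
Qed.

Lemma weak_ball_sym k mu nu : weak_ball k mu nu -> weak_ball k nu mu.
Proof. by move=> H i ik; rewrite distrC; exact: H. Qed.

Definition thickening (k : nat) A : set (borel_prob X) :=
  [set nu | exists2 mu, A mu & weak_ball k mu nu].

Lemma closure_thickening (T : Type) (F : set_system T) (u : T -> borel_prob X)
    (k : T -> nat) A mu : ProperFilter F ->
  (forall m, F [set t | (m <= k t)%N]) -> F [set t | thickening (k t) A (u t)] ->
  u @ F --> mu -> closure A mu.
Proof.
move=> FF Fk FA umu O /weak_ball_base[m mO].
have : F [set t | weak_ball m.*2.+1 mu (u t)].
  by apply: umu; exact: weak_ball_nbhs.
move=> H; have [t [[mt [a Aa at_]] Hm]] := filter_ex (filterI (filterI (Fk m.*2.+1) FA) H).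
exists a; split => //; apply: (mO m) => //.
exact: (weak_ball_triangle (k' := m.*2.+1) (leqnn _) Hm (weak_ballS mt at_)).
Qed.

(** Measures with the same [code k] have integrals of the first [k] tests less than [1 / k.+1]
    apart. Codes are countable, and one measure of [K] is picked for each code that occurs, with
    [m0] as default. *)
Lemma dense_measures (K : set (borel_prob X)) : K !=set0 ->
  exists m : nat -> borel_prob X, (forall j, K (m j)) /\
    forall mu, K mu -> forall k, exists j, weak_ball k mu (m j).
Proof.
move=> [m0 Km0].
pose code k mu := [seq Num.floor (k.+1%:R * mean mu (D i)) | i <- iota 0 k].
pose pick (p : nat * seq int) := xget m0 [set mu | K mu /\ code p.1 mu = p.2].
exists (fun j => oapp pick m0 (unpickle j)); split=> [j|mu Kmu k].
  case: unpickle => [p|//] /=; rewrite /pick.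
  by case: xgetP => [mu _ []|_].
exists (pickle (k, code k mu)) => i ik; rewrite pickleK/=.
have [_ /(congr1 (fun s => nth 0 s i))] :
    [set nu | K nu /\ code k nu = code k mu] (pick (k, code k mu)).
  by apply: (@xgetI _ _ _ mu).
rewrite !(nth_map 0%N) ?size_iota// !nth_iota// add0n => E.
set a := mean _ _ in E *; set b := mean _ _ in E *.
have := ge_floor (k.+1%:R * a); have := floorD1_gt (k.+1%:R * a).
have := ge_floor (k.+1%:R * b); have := floorD1_gt (k.+1%:R * b).
rewrite -E !intrD => h1 h2 h3 h4.
rewrite -(ltr_pM2l (x := k.+1%:R)) ?ltr0n// divff ?pnatr_eq0//.
have k0 : 0 < k.+1%:R :> R by rewrite ltr0n.
rewrite -[X in X * `|_|](gtr0_norm k0) -normrM mulrBr ltr_norml.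
by move: h1 h2 h3 h4; move: (k.+1%:R * a) (k.+1%:R * b) => *; apply/andP; split; lra.
Qed.

End WeakBalls.

(** * Empirical measures *)

Section EmpiricalMeasures.
Context {R : realType} {X : pmetricType R}.
Hypothesis X_compact : compact [set: X].
Variable f : X -> X.
Implicit Types (g : X -> R) (x : X).

Definition orbit_sum g x (n : nat) : R := \sum_(j < n) g (iter j f x).

Lemma mean_empirical g x n : continuous g ->
  mean (empirical f x n) g = orbit_sum g x n.+1 / n.+1%:R.
Proof.
move=> cg.
(* Nonnegative functions come first; a general [g] is shifted by its bound [b], and the constant is
   then removed. *)
have Hge0 (h : X -> R) : continuous h -> (forall y, 0 <= h y) ->
    mean (empirical f x n) h = orbit_sum h x n.+1 / n.+1%:R.
  move=> ch h0; have mh : measurable_fun [set: borel X] (EFin \o h).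
    by apply/measurable_EFinP; exact: continuous_borel.
  rewrite /mean /Rintegral.
  rewrite [X in fine X](_ : _ = (n.+1%:R^-1)%:E * \sum_(j < n.+1) (h (iter j f x))%:E)%E.
    by rewrite sumEFin -EFinM/= mulrC.
  rewrite (@ge0_integral_mscale _ _ _ (msum (fun k => dirac (iter k f x : borel X)) n.+1) _ measurableT
    (n.+1%:R^-1)%:nng (EFin \o h))//; last by move=> y _; rewrite lee_fin.
  congr (_ * _)%E; rewrite ge0_integral_measure_sum//; last by move=> y _; rewrite lee_fin.
  apply: eq_bigr => j _; rewrite integral_dirac//.
  by rewrite diracT mul1e.
have [b b0 gb] := continuous_bounded X_compact cg.
have cc := @cont_cst R X.
have := Hge0 (fun y => g y + b); rewrite meanD// mean_cst => H.
have {}H := H (cont_add cg (cc b)).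
rewrite -[LHS](addrK b) H; last first.
  by move=> y; have := gb y; rewrite ler_norml -lerBlDr sub0r => /andP[].
rewrite /orbit_sum big_split/= sumr_const card_ord mulrDl -[b *+ _]mulr_natr.
by rewrite mulfK ?addrK// pnatr_eq0.
Qed.

Lemma cluster_seq (Y : topologicalType) (u : nat -> Y) (y : Y) :
  cluster (u @ \oo) y <->
  forall (O : set Y) m, nbhs y O -> exists2 n, (m <= n)%N & O (u n).
Proof.
split=> [H O m Oy|H A O [m _ mA] Oy].
  have mm : (u @ \oo) (u @` [set n | (m <= n)%N]).
    by exists m => // n /= mn; exists n.
  by have [_ [[n /= mn <-] On]] := H _ _ mm Oy; exists n.
by have [n mn On] := H O m Oy; exists (u n); split => //; apply: mA.
Qed.

Variable D : nat -> X -> R.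
Hypothesis D_continuous : forall i, continuous (D i).
Hypothesis D_dense : forall (g : X -> R) (e : R), continuous g -> 0 < e ->
  exists i, forall x, `|g x - D i x| <= e.

Lemma V_weak_ball x (mu : borel_prob X) : V_ f x mu <->
  forall k m, exists2 n, (m <= n)%N & weak_ball D k mu (empirical f x n).
Proof.
rewrite /V_; split=> [/cluster_seq H k m|H].
  by apply: H; exact: weak_ball_nbhs.
apply/cluster_seq => O m /(weak_ball_base X_compact D_continuous D_dense)[k kO].
by have [n mn kn] := H k m; exists n => //; apply: (kO k).
Qed.

(** Otherwise, by compactness, the empirical measures at the bad times accumulate at a point of
    [V_ f x], hence of [A], whose ball they should have avoided. *)
Lemma empirical_thickening x (A : set (borel_prob X)) k : V_ f x `<=` A ->
  exists m, forall n, (m <= n)%N -> thickening D k A (empirical f x n).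
Proof.
move=> VA; apply: contrapT => /forallNP H.
pose bad m := [set n | (m <= n)%N /\ ~ thickening D k A (empirical f x n)].
have badN m : bad m !=set0.
  by have /existsNP[n /not_implyP[mn nA]] := H m; exists n.
pose G := filter_from [set: nat] bad.
have GP : ProperFilter G.
  apply: filter_from_proper => // ; apply: filter_from_filter; first by exists 0%N.
  move=> i j _ _; exists (maxn i j) => // n; rewrite /bad/= geq_max => -[/andP[? ?] ?].
  by split.
have [mu [_ muG]] := @borel_prob_compact R X X_compact
  ((fun n => empirical f x n : borel_prob X) @ G) _ filterT.
have Amu : A mu.
  apply: VA => B O [m _ mB] Omu; apply: muG => //.
  by exists m => // n [mn _]; apply: mB.
have : ((fun n => empirical f x n : borel_prob X) @ G) (~` thickening D k A).
  by exists 0%N => // n [].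
move=> /muG/(_ (weak_ball_nbhs D_continuous k mu))[nu [nuA munu]].
by apply: nuA; exists mu.
Qed.

End EmpiricalMeasures.

(** * Mixtures of limits and total variation *)

Section Mixtures.
Context {R : realType} {X : pmetricType R}.
Hypothesis X_compact : compact [set: X].
Implicit Types (mu nu lam : borel_prob X) (A : set (borel_prob X)).

Lemma bump_cvg (U : set X) x : open U -> bump U n x @[n --> \oo] --> (\1_U x : R).
Proof.
move=> oU; apply: cvg_near_cst; have [Ux|Ux] := pselect (U x).
  have d0 := dcompl_gt0 oU Ux.
  exists (Num.truncn (dcompl U x)^-1).+1 => // n /= nd.
  rewrite indicE mem_set//; apply/min_idPl.
  rewrite -ler_pdivrMr// div1r ltW// (lt_le_trans (truncnS_gt _))//.
  by rewrite ler_nat.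
by apply: nearW => n; rewrite bump_out// indicE memNset.
Qed.

Lemma mean_bump_cvg mu (U : set X) : open U ->
  mean mu (bump U n) @[n --> \oo] --> fine (mu (U : set (borel X))).
Proof.
move=> oU; have mU := open_borel oU.
have mb n : measurable_fun [set: borel X] (EFin \o bump U n).
  by apply/measurable_EFinP; apply: continuous_borel; exact: bump_continuous.
have [||||_ _] := @dominated_convergence _ (borel X) R mu setT measurableT
    (fun n => EFin \o bump U n) (fun x => (\1_U x)%:E) (cst 1%E) mb.
- by apply/measurable_EFinP; exact: measurable_indic.
- by apply: aeW => x _; apply: cvg_EFin; [exact: nearW|exact: bump_cvg].
- exact: (continuous_integrable X_compact mu (@cont_cst R X 1)).
- by apply: aeW => x n _ /=; rewrite lee_fin ger0_norm ?bump_ge0// bump_le1.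
rewrite integral_indic// setIT => H.
by apply: fine_cvg; rewrite fineK// fin_num_measure.
Qed.

(** Integrals of bumps determine the values on open sets, which form a pi-system generating the
    Borel sets. Mixtures of two measures are the case [c = 0]. *)
Lemma mean_mixture (a b c : R) lam mu1 mu2 nu : 0 <= a -> 0 <= b -> 0 <= c ->
  (forall g, continuous g ->
    mean nu g = a * mean lam g + b * mean mu1 g + c * mean mu2 g) ->
  forall B : set (borel X), measurable B ->
    fine (nu B) = a * fine (lam B) + b * fine (mu1 B) + c * fine (mu2 B).
Proof.
move=> a0 b0 c0 H B mB.
pose m : {measure set (borel X) -> \bar R} :=
  measure_add (measure_add (mscale (NngNum a0) lam) (mscale (NngNum b0) mu1))
    (mscale (NngNum c0) mu2).
have mE C : measurable C ->
    m C = (a * fine (lam C) + b * fine (mu1 C) + c * fine (mu2 C))%:E.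
  move=> mC; rewrite !EFinD !EFinM !fineK ?fin_num_measure//.
  transitivity (measure_add (mscale (NngNum a0) lam) (mscale (NngNum b0) mu1) C +
    mscale (NngNum c0) mu2 C)%E; first exact: measure_addE.
  by congr (_ + _)%E; exact: measure_addE.
have open_eq (U : set X) : open U -> nu U = m U.
  move=> oU; have mU := open_borel oU; rewrite mE//.
  rewrite -[LHS]fineK ?fin_num_measure//; congr EFin.
  rewrite -(cvg_lim (@Rhausdorff R) (@mean_bump_cvg nu U oU)); apply/cvg_lim => //.
  have -> : (fun n => mean nu (bump U n)) =
    (fun n => a * mean lam (bump U n) + b * mean mu1 (bump U n) + c * mean mu2 (bump U n)).
    by apply/funext => n; apply: H; exact: bump_continuous.
  by apply: cvgD; [apply: cvgD|]; apply: cvgMr; exact: mean_bump_cvg.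
suff -> : nu B = m B by rewrite mE.
apply: (@measure_unique _ R (borel X) (@open X) (fun=> setT) erefl _ _ _ nu m open_eq _ B mB).
- exact: openI.
- by move=> _; exact: openT.
- by rewrite bigcup_const.
- by move=> _; rewrite [X in (X < _)%E](_ : _ = 1%E) ?ltry//; exact: (@probability_setT _ _ _ nu).
Qed.

Lemma mixture_exists (w : R) mu1 mu2 : 0 <= w <= 1 -> exists mu : borel_prob X,
  forall g, continuous g -> mean mu g = w * mean mu1 g + (1 - w) * mean mu2 g.
Proof.
move=> /andP[w0 w1]; apply: riesz_representation => //.
- by move=> g h cg ch; rewrite !meanD//; ring.
- by move=> a g cg; rewrite !meanZ//; ring.
- move=> g h cg ch gh; apply: lerD; apply: ler_wpM2l => //; first exact: mean_le.
    by rewrite subr_ge0.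
  exact: mean_le.
- by rewrite !mean_cst; ring.
Qed.

(** Approximants of [mu1] and [mu2] in [A], mixed with the same [w], stay in the ball around
    [mu]. *)
Lemma closure_mixture (D : nat -> X -> R) (w : R) A mu1 mu2 mu :
  (forall i, continuous (D i)) ->
  (forall (g : X -> R) (e : R), continuous g -> 0 < e ->
    exists i, forall x, `|g x - D i x| <= e) ->
  0 <= w <= 1 -> closure A mu1 -> closure A mu2 ->
  (forall g, continuous g -> mean mu g = w * mean mu1 g + (1 - w) * mean mu2 g) ->
  closed_convex_hull A mu.
Proof.
move=> cD dD w01 A1 A2 muE O /(weak_ball_base X_compact cD dD)[k /(_ k (leqnn k)) kO].
have [a1 [Aa1 a1k]] := A1 _ (weak_ball_nbhs cD k mu1).
have [a2 [Aa2 a2k]] := A2 _ (weak_ball_nbhs cD k mu2).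
have [a aE] := mixture_exists a1 a2 w01.
have /andP[w0 w1] := w01; have w1' : 0 <= 1 - w by rewrite subr_ge0.
exists a; split; last first.
  apply: kO => i ik; rewrite aE// muE// opprD addrACA -!mulrBr.
  have := a1k i ik; have := a2k i ik.
  move: (k.+1%:R^-1) (_ - _) (_ - _) => d u v.
  rewrite !ltr_norml => /andP[u1 u2] /andP[v1 v2].
  (* The strict bound has to come from a term of positive weight, hence the case [w = 0]. *)
  by have [->|w0'] := eqVneq w 0; [|have wgt0 : 0 < w by rewrite lt_neqAle eq_sym w0'];
    apply/andP; split; nra.
exists 2%N, (fun i => if i == ord0 then w else 1 - w),
  (fun i => if i == ord0 then a1 else a2); split.
- by move=> i; case: ifP.
- by rewrite !big_ord_recl big_ord0/= addr0 addrC subrK.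
- by move=> i; case: ifP.
move=> B mB; rewrite !big_ord_recl big_ord0/= adde0.
have := @mean_mixture w (1 - w) 0 a1 a2 a2 a w0 w1' (lexx 0) _ B mB.
move=> /(_ _)/wrap[g cg|]; first by rewrite mul0r addr0 aE.
rewrite mul0r addr0 => E.
by rewrite -[LHS]fineK ?fin_num_measure// E EFinD !EFinM !fineK ?fin_num_measure.
Qed.

(** With [mu] the mixture of [mu1] and [mu2] with normalised weights, [nu] is [a lam + (1 - a) mu],
    so [mu B - nu B = a (mu B - lam B)]. The condition [a < 1] allows the normalisation. *)
Lemma tv_dist_mixture (D : nat -> X -> R) (a b c : R) A lam mu1 mu2 nu :
  (forall i, continuous (D i)) ->
  (forall (g : X -> R) (e : R), continuous g -> 0 < e ->
    exists i, forall x, `|g x - D i x| <= e) ->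
  0 <= a -> 0 <= b -> 0 <= c -> a + b + c = 1 -> a < 1 ->
  closure A mu1 -> closure A mu2 ->
  (forall g, continuous g ->
    mean nu g = a * mean lam g + b * mean mu1 g + c * mean mu2 g) ->
  exists2 mu, closed_convex_hull A mu & (tv_dist mu nu <= a%:E)%E.
Proof.
move=> cD dD a0 b0 c0 abc a1 A1 A2 nuE.
have bc : 0 < b + c by lra.
pose w := b / (b + c).
have w01 : 0 <= w <= 1.
  by rewrite divr_ge0 ?(ltW bc)//= ler_pdivrMr// mul1r lerDl.
have [mu muE] := mixture_exists mu1 mu2 w01.
exists mu; first exact: closure_mixture muE.
apply: ge_ereal_sup => _ [B mB <-].
have nuB := mean_mixture a0 b0 c0 nuE mB.
have /andP[w0 w1] := w01; have w1' : 0 <= 1 - w by rewrite subr_ge0.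
have := @mean_mixture w (1 - w) 0 mu1 mu2 mu2 mu w0 w1' (lexx 0) _ B mB.
move=> /(_ _)/wrap[g cg|]; first by rewrite mul0r addr0 muE.
rewrite mul0r addr0 => muB.
have fine01 (m : borel_prob X) : 0 <= fine (m B) <= 1.
  rewrite fine_ge0//= -lee_fin fineK ?fin_num_measure//.
  exact: (@probability_le1 _ _ _ m).
rewrite -[mu B]fineK ?fin_num_measure// -[nu B]fineK ?fin_num_measure//.
rewrite -EFinB abse_EFin lee_fin.
have wbc : w * (b + c) = b by rewrite divfK// gt_eqF.
have -> : fine (mu B) - fine (nu B) = a * (fine (mu B) - fine (lam B)).
  rewrite nuB -addrA (_ : a = 1 - (b + c)); last by lra.
  have -> : b * fine (mu1 B) + c * fine (mu2 B) = (b + c) * fine (mu B).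
    rewrite muB mulrDr mulrA [_ * w]mulrC wbc mulrA mulrBr mulr1 [_ * w]mulrC.
    by rewrite wbc addrAC subrr add0r.
  ring.
rewrite normrM ger0_norm// ler_piMr// ler_norml.
by have := fine01 mu; have := fine01 lam; move=> /andP[? ?] /andP[? ?]; apply/andP; split; lra.
Qed.

End Mixtures.

(** * Shadowing a sequence of targets *)

Section Shadowing.
Context {R : realType} {X : pmetricType R}.
Hypothesis X_compact : compact [set: X].
Variable f : X -> X.
Hypothesis f_continuous : continuous f.
Variable M : nat -> R -> nat.
Hypothesis M_spec : non_uniform_specification f M.

Lemma iter_continuous n : continuous (iter n f).
Proof.
elim: n => [|n IHn] x; first exact: cvg_id.
by apply: (@continuous_comp _ _ _ (iter n f) f); [exact: IHn|exact: f_continuous].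
Qed.

(* The gaps depend on the lengths n.+1 and 1 of the first two blocks only, so
   that the second gap is bounded independently of n. *)
Lemma three_blocks (eps : R) (u v w : X) (n N : nat) : 0 < eps ->
  let s := (n + M n.+1 eps)%N in let a := (s + M 1 eps)%N in
  exists z, [/\ forall j, (j <= n)%N -> mdist (iter j f u) (iter j f z) <= eps,
    mdist v (iter s f z) <= eps &
    forall j, (a <= j <= N)%N -> mdist (iter (j - a) f w) (iter j f z) <= eps].
Proof.
move=> eps0 s a; have [[M0 _ _] spec] := M_spec.
have Mn : (0 < M n.+1 eps)%N by exact: M0.
have M1 : (0 < M 1 eps)%N by exact: M0.
(* [maxn a N] keeps the third block well formed when [N < a], in which case the last claim is
   void. *)
have [||||| z zP] := spec eps 3%N (nth u [:: u; v; w]) (nth 0%N [:: 0; s; a])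
  (nth 0%N [:: n; s; maxn a N]) => //.
- by case=> [|[|[|//]]] _ //=; rewrite leq_maxl.
- by case=> [|[|//]] _ /=; rewrite /s /a; lia.
- by case=> [|[|//]] _ /=; rewrite ?subn0 ?subnn /a /s addKn.
exists z; split.
- by move=> j jn; have := zP 0%N j isT; rewrite /= subn0; exact.
- by have := zP 1%N s isT; rewrite /= subnn; apply; rewrite leqnn.
- move=> j /andP[aj jN]; apply: (zP 2%N j isT).
  by rewrite /= aj leq_max jN orbT.
Qed.

Variables (r : R) (t : nat -> nat).
Hypothesis r_gt0 : 0 < r.

(** Halving makes [err k] the sum of all errors of larger index. *)
Definition err (k : nat) : R := r / 2 ^+ k.
(** The point [q k] is followed at time [visit k] only, and the target [x k] from [start k] on. The
    gaps are those required after a block of length [(t k).+1] and after a block of length 1. *)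
Definition visit k := (t k + M (t k).+1 (err k.+1))%N.
Definition start k := (visit k + M 1 (err k.+1))%N.

Lemma err_gt0 k : 0 < err k.
Proof. by rewrite divr_gt0// exprn_gt0. Qed.

Lemma errS k : err k = err k.+1 + err k.+1.
Proof. by rewrite /err exprS; field; rewrite expf_neq0. Qed.

Lemma err_le k m : (k <= m)%N -> err m <= err k.
Proof.
move=> /subnK <-; elim: (m - k)%N => [//|n IHn]; rewrite addSn (le_trans _ IHn)//.
by rewrite [leRHS]errS lerDl ltW// err_gt0.
Qed.

Lemma err_small (e : R) : 0 < e -> exists m, forall k, (m <= k)%N -> err k < e.
Proof.
move=> e0; pose m := (Num.truncn (r / e)).+1.
exists m => k mk; rewrite (le_lt_trans (err_le mk))//.
rewrite /err ltr_pdivrMr ?exprn_gt0// mulrC -ltr_pdivrMr//.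
rewrite (lt_le_trans (truncnS_gt _))// -natrX ler_nat ltnW//.
exact: ltn_expl.
Qed.

Lemma visit_gt k : (t k < visit k)%N.
Proof.
have [[M0 _ _] _] := M_spec.
by rewrite /visit -{1}[t k]addn0 ltn_add2l M0// err_gt0.
Qed.

Lemma start_gt k : (visit k < start k)%N.
Proof.
have [[M0 _ _] _] := M_spec.
by rewrite /start -{1}[visit k]addn0 ltn_add2l M0// err_gt0.
Qed.

Hypothesis t_start : forall k, (start k <= t k.+1)%N.

Lemma t_lt k : (t k < t k.+1)%N.
Proof. by rewrite (ltn_trans (visit_gt k))// (leq_trans (start_gt k)). Qed.

Lemma t_ge k : (k <= t k)%N.
Proof. by elim: k => // k IHk; rewrite (leq_ltn_trans IHk)// t_lt. Qed.

Lemma t_le k m : (k <= m)%N -> (t k <= t m)%N.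
Proof.
move=> /subnK <-; elim: (m - k)%N => [//|n IHn].
by rewrite (leq_trans IHn)// addSn ltnW// t_lt.
Qed.

Definition traces (q x : nat -> X) (z : X) : Prop :=
  (forall k, mdist (q k) (iter (visit k) f z) <= err k) /\
  (forall k j, (start k <= j <= t k.+1)%N ->
    mdist (iter (j - start k) f (x k)) (iter j f z) <= err k).

(** On [[0, t k]] the errors of the successive [z_] telescope to less than [err k], and this passes
    to a cluster point [z]: a larger distance at some time would be an open condition, met by a
    later [z_ n]. The error [err k] on a block is [err k.+1] for the target plus [err k.+1] for the
    limit. *)
Lemma tracing_point (u : X) (q x : nat -> X) :
  exists2 z, mdist u z <= r & traces q x z.
Proof.
have /choice[S SP] : forall p : nat * X, exists z,
    [/\ forall j, (j <= t p.1)%N -> mdist (iter j f p.2) (iter j f z) <= err p.1.+1,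
      mdist (q p.1) (iter (visit p.1) f z) <= err p.1.+1 &
      forall j, (start p.1 <= j <= t p.1.+1)%N ->
        mdist (iter (j - start p.1) f (x p.1)) (iter j f z) <= err p.1.+1].
  by move=> [k v]; apply: three_blocks; exact: err_gt0.
pose z_ := fix z_ k := if k is k'.+1 then S (k', z_ k') else u.
have z_near k n j : (j <= t k)%N ->
    mdist (iter j f (z_ k)) (iter j f (z_ (n + k)%N)) <= err k - err (n + k)%N.
  move=> jk; elim: n => [|n IHn]; first by rewrite add0n mdistxx subrr.
  rewrite (le_trans (metric_triangle _ (iter j f (z_ (n + k)%N)) _))//.
  have [/(_ j) + _ _] := SP ((n + k)%N, z_ (n + k)%N).
  rewrite /= (leq_trans jk) ?t_le ?leq_addl// => /(_ isT) H.
  by have := errS (n + k); move: H IHn; rewrite addSn; lra.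
have [z [_ zcl]] := X_compact (F := z_ @ \oo) _ filterT.
have z_lim k j : (j <= t k)%N -> mdist (iter j f (z_ k)) (iter j f z) <= err k.
  move=> jk; rewrite leNgt; apply/negP => far.
  have cd : continuous (fun y => mdist (iter j f y) (iter j f (z_ k))).
    move=> y; apply: (@continuous_comp _ _ _ (iter j f) (fun y => mdist y _)).
      exact: iter_continuous.
    exact: mdist_continuous.
  rewrite metric_sym in far.
  have [n kn] := (cluster_seq _ _).1 zcl _ k (cd z _ (lt_nbhsr far)).
  rewrite /= metric_sym ltNge => /negP; apply.
  have := z_near k (n - k)%N j jk; rewrite subnK// => /le_trans; apply.
  by rewrite gerBl ltW// err_gt0.
exists z; first by have := z_lim 0%N 0%N (leq0n _); rewrite /= /err expr0 divr1.
split=> [k|k j kj].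
  rewrite errS (le_trans (metric_triangle _ (iter (visit k) f (z_ k.+1)) _))//.
  have [_ H _] := SP (k, z_ k); rewrite lerD//.
  by apply: z_lim; rewrite (leq_trans _ (t_start k))// ltnW// start_gt.
rewrite errS (le_trans (metric_triangle _ (iter j f (z_ k.+1)) _))//.
have [_ _ /(_ j kj) H] := SP (k, z_ k); rewrite lerD//.
by apply: z_lim; case/andP: kj.
Qed.

End Shadowing.

(** * Lower and upper limits *)

Section LimitsInferiorAndSuperior.
Context {R : realType}.
Implicit Types (u : nat -> \bar R).

Lemma limn_einf_lt u (x : \bar R) N : (limn_einf u < x)%E ->
  exists2 n, (N <= n)%N & (u n < x)%E.
Proof.
rewrite limn_einf_lim => ux.
have : (einfs u N < x)%E.
  apply: le_lt_trans ux; rewrite (cvg_lim _ (@cvg_einfs_sup _ u))//.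
  by apply: ereal_sup_ubound; exists N.
by move=> /ereal_inf_lt[_ [n /= Nn <-]] ?; exists n.
Qed.

Lemma limn_einf_eq0 u : (forall n, (0 <= u n)%E) ->
  (forall (e : R) N, 0 < e -> exists2 n, (N <= n)%N & (u n <= e%:E)%E) ->
  limn_einf u = 0%E.
Proof.
move=> u0 ue; rewrite limn_einf_lim (cvg_lim _ (@cvg_einfs_sup _ u))//.
apply/eqP; rewrite eq_le; apply/andP; split.
  apply: ge_ereal_sup => _ [N _ <-]; apply/lee_addgt0Pr => e e0.
  have [n Nn une] := ue e N e0; rewrite add0e (le_trans _ une)//.
  by apply: ereal_inf_lbound; exists n.
apply: (@le_trans _ _ (einfs u 0)); last by apply: ereal_sup_ubound; exists 0%N.
by apply: le_ereal_inf_tmp => _ [n _ <-].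
Qed.

Lemma limn_esup_eq1 u : (forall n, (u n <= 1)%E) ->
  (forall (e : R) N, 0 < e -> exists2 n, (N <= n)%N & ((1 - e)%:E <= u n)%E) ->
  limn_esup u = 1%E.
Proof.
move=> u1 ue; rewrite limn_esup_lim (cvg_lim _ (@cvg_esups_inf _ u))//.
apply/eqP; rewrite eq_le; apply/andP; split.
  apply: (@le_trans _ _ (esups u 0)); first by apply: ereal_inf_lbound; exists 0%N.
  by apply: ge_ereal_sup => _ [n _ <-].
apply: le_ereal_inf_tmp => _ [N _ <-]; apply/lee_addgt0Pr => e e0.
have [n Nn une] := ue e N e0.
rewrite -leeBlDr// -EFinB (le_trans une)//.
by apply: ereal_sup_ubound; exists n.
Qed.

End LimitsInferiorAndSuperior.

(** * Choice of the times *)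

Section Times.
Context {R : realType}.
Variables (M : nat -> R -> nat) (tau : R).
Hypothesis M_rate : gap_rate M = tau%:E.

(** The lower limit at [eps] is at most [tau], which gives arbitrarily large lengths with gap below
    [tau + d / 2] times the length; the other [d / 2] absorbs the constant [c]. *)
Lemma small_gap (eps d : R) (c N : nat) : 0 < eps -> 0 < d ->
  exists2 n, (N <= n)%N & (M n.+1 eps + c)%:R <= (tau + d) * n.+1%:R.
Proof.
move=> eps0 d0; have d20 : 0 < d / 2 by rewrite divr_gt0.
have : (limn_einf (fun n => ((M n eps)%:R / n%:R)%:E : \bar R) < (tau + d / 2)%:E)%E.
  apply: (@le_lt_trans _ _ tau%:E); last by rewrite lte_fin ltrDl.
  by rewrite -M_rate; apply: ereal_sup_ubound; exists eps.
pose N' := maxn N.+1 (Num.truncn (c%:R / (d / 2))).+1.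
move=> /(limn_einf_lt N')[[|n]]; rewrite geq_max => /andP[Nn cn]//.
have n0 : 0 < n.+1%:R :> R by rewrite ltr0n.
rewrite lte_fin ltr_pdivrMr// => Mn; exists n => //.
have : c%:R <= d / 2 * n.+1%:R.
  rewrite mulrC -ler_pdivrMr// ltW// (lt_le_trans (truncnS_gt _))//.
  by rewrite ler_nat.
by move: Mn; rewrite natrD (_ : tau + d = tau + d / 2 + d / 2) ?mulrDl; lra.
Qed.

(** Each time is chosen knowing the previous ones, beyond a threshold that may depend on [start k].
    The precision is [err k.+2] because [start k.+1] is computed with it, and [t 0 = 0] has no gap
    estimate. *)
Lemma times_exist (r : R) (thr : nat -> nat -> nat) : 0 < r ->
  exists t : nat -> nat, forall k,
    [/\ (start M r t k <= t k.+1)%N, (thr k (start M r t k) <= t k.+1)%N &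
        (start M r t k.+1 - t k.+1)%:R <= (tau + k.+1%:R^-1) * (t k.+1).+1%:R].
Proof.
move=> r0.
have /choice[B BP] : forall p : nat * nat, exists b,
    (maxn p.2 (thr p.1 p.2) <= b)%N /\
    (M b.+1 (err r p.1.+2) + M 1 (err r p.1.+2))%:R <= (tau + p.1.+1%:R^-1) * b.+1%:R.
  move=> [k a] /=; have [|| b ab bM] := @small_gap (err r k.+2) k.+1%:R^-1
    (M 1 (err r k.+2)) (maxn a (thr k a)).
  - exact: err_gt0.
  - by rewrite invr_gt0.
  - by exists b.
pose t := fix t k := if k is k'.+1 then
  B (k', (t k' + M (t k').+1 (err r k'.+1) + M 1 (err r k'.+1))%N) else 0%N.
exists t => k; have [] := BP (k, start M r t k); rewrite geq_max => /andP[? ?] H.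
by split=> //; rewrite /start /visit -addnA addKn.
Qed.

End Times.

(** * Orbit averages of a shadowing point *)

Section OrbitSums.
Context {R : realType} {X : pmetricType R}.
Hypothesis X_compact : compact [set: X].
Variable f : X -> X.
Implicit Types (g : X -> R).

Lemma orbit_sumD g x m n :
  orbit_sum f g x (m + n) = orbit_sum f g x m + orbit_sum f g (iter m f x) n.
Proof.
rewrite /orbit_sum big_split_ord/=; congr (_ + _).
by apply: eq_bigr => i _; rewrite -iterD addnC.
Qed.

Lemma orbit_sum_mean g x n : continuous g ->
  orbit_sum f g x n = n%:R * mean (empirical f x n.-1) g.
Proof.
move=> cg; case: n => [|n]; first by rewrite /orbit_sum big_ord0 mul0r.
by rewrite mean_empirical// mulrC divfK// pnatr_eq0.
Qed.

Lemma orbit_sum_bounded g (b : R) x n : (forall y, `|g y| <= b) ->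
  `|orbit_sum f g x n| <= n%:R * b.
Proof.
move=> gb; rewrite (le_trans (ler_norm_sum _ _ _))//.
rewrite -[n in leRHS]card_ord mulr_natl -sumr_const; exact: ler_sum.
Qed.

Lemma orbit_sum_dist g (e : R) x y n :
  (forall j, (j < n)%N -> `|g (iter j f x) - g (iter j f y)| <= e) ->
  `|orbit_sum f g x n - orbit_sum f g y n| <= n%:R * e.
Proof.
move=> gxy; rewrite /orbit_sum -sumrB (le_trans (ler_norm_sum _ _ _))//.
rewrite -[n in leRHS]card_ord mulr_natl -sumr_const.
by apply: ler_sum => i _; exact: gxy.
Qed.

Variables (M : nat -> R -> nat) (r : R) (t : nat -> nat).
Hypothesis M_spec : non_uniform_specification f M.
Hypothesis r_gt0 : 0 < r.
Hypothesis t_start : forall k, (start M r t k <= t k.+1)%N.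
Local Notation start := (start M r t).
Local Notation visit := (visit M r t).
Local Notation err := (err r).

Lemma traces_dist q x z k j : traces f M r t q x z ->
  (start k + j <= t k.+1)%N ->
  mdist (iter j f (x k)) (iter j f (iter (start k) f z)) <= err k.
Proof.
move=> [_ H] jk; have := H k (start k + j)%N.
by rewrite leq_addr jk addKn addnC iterD; exact.
Qed.

Lemma visit_ge k : (k <= visit k)%N.
Proof.
by rewrite (leq_trans (t_ge M_spec r_gt0 t_start k))// ltnW// (visit_gt M_spec).
Qed.

Lemma start_ge k : (k <= start k)%N.
Proof. by rewrite (leq_trans (visit_ge k))// ltnW// (start_gt M_spec). Qed.

Lemma traces_transitive q x z : traces f M r t q x z ->
  (forall U : set X, open U -> U !=set0 -> forall m, exists2 k, (m <= k)%N & U (q k)) ->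
  Trans f z.
Proof.
move=> [qz _] qdense; apply/seteqP; split => // y _.
apply/cluster_seq => O m /nbhs_mdist[e e0 eO].
have e20 : 0 < e / 2 by rewrite divr_gt0.
have [n nP] := err_small r_gt0 e20.
have [k nk qk] := qdense _ (@open_interior _ (ball y (e / 2)))
  (ex_intro _ y (nbhsx_ballx y _ e20)) (maxn m n).
move: nk; rewrite geq_max => /andP[mk nk].
exists (visit k); first by rewrite (leq_trans mk) ?visit_ge.
apply: eO; rewrite (le_lt_trans (metric_triangle _ (q k) _))// (splitr e) ltrD//.
  by have := interior_subset qk; rewrite ballEmdist.
by rewrite (le_lt_trans (qz k))// nP.
Qed.

(** The times before [start k] are at most a fraction [1 / k.+1] of the whole. They cost [e / 8] as
    terms of the sum and [e / 8] through the change of denominator; uniform continuity costs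
    [e / 2]. *)
Lemma shadow_mean q x z g (e : R) : traces f M r t q x z -> continuous g -> 0 < e ->
  exists k0, forall k c, (k0 <= k)%N -> (k.+1 * start k <= c)%N ->
    (start k + c <= t k.+1)%N ->
    `|mean (empirical f z (start k + c)) g - mean (empirical f (x k) c) g| < e.
Proof.
move=> zx cg e0; have [b b0 gb] := continuous_bounded X_compact cg.
have e20 : 0 < e / 2 by rewrite divr_gt0.
have e80 : 0 < e / 8 by rewrite divr_gt0.
have [d d0 gd] := uniformly_continuous X_compact cg e20.
have [n nP] := err_small r_gt0 d0.
exists (maxn n (Num.truncn (b / (e / 8)))) => k c; rewrite geq_max => /andP[nk bk] ac ct.
rewrite !mean_empirical// -addnS orbit_sumD.
set a := start k in ac ct *; set y := iter a f z.
have a0 := orbit_sum_bounded z a gb.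
have sx := orbit_sum_bounded (x k) c.+1 gb.
have sy : `|orbit_sum f g (x k) c.+1 - orbit_sum f g y c.+1| <= c.+1%:R * (e / 2).
  apply: orbit_sum_dist => j jc; apply/ltW/gd.
  rewrite (le_lt_trans _ (nP k nk))// (traces_dist zx)//.
  by rewrite (leq_trans _ ct)// leq_add2l.
move: a0 sx sy.
move: (orbit_sum f g z a) (orbit_sum f g (x k) c.+1) (orbit_sum f g y c.+1) => Sa Sx Sy a0 sx sy.
have m0 : 0 < c.+1%:R :> R by rewrite ltr0n.
have am0 : 0 < (a + c.+1)%:R :> R by rewrite ltr0n addnS.
have be : a%:R * b <= c.+1%:R * (e / 8).
  rewrite -ler_pdivrMr// -mulrA; apply: (@le_trans _ _ (a%:R * k.+1%:R)).
    by rewrite ler_wpM2l// ltW// (lt_le_trans (truncnS_gt _))// ler_nat.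
  by rewrite -natrM ler_nat mulnC (leq_trans ac).
rewrite natrD in am0 *; move: (a%:R) (c.+1%:R) (ler0n R a) m0 am0 a0 sx sy be.
move=> A m A0 m0 am0 a0 sx sy be.
have -> : (Sa + Sy) / (A + m) - Sx / m = (Sa + (Sy - Sx) - A * (Sx / m)) / (A + m).
  by field; rewrite !gt_eqF.
rewrite normrM normfV (gtr0_norm am0) ltr_pdivrMr//.
have sxm : `|A * (Sx / m)| <= A * b.
  rewrite normrM (ger0_norm A0) ler_wpM2l// normrM normfV (gtr0_norm m0).
  by rewrite ler_pdivrMr// mulrC.
move: sx sy; rewrite distrC => _ sy.
rewrite (le_lt_trans (ler_normB _ _))// (le_lt_trans (lerD (ler_normD _ _) sxm))//.
rewrite (le_lt_trans (lerD (lerD a0 sy) (lexx _)))//.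
have em : 0 < m * e by exact: mulr_gt0.
have Ae : 0 <= A * e by rewrite mulr_ge0// ltW.
lra.
Qed.

Lemma shadow_V q x z D nu : (forall i, continuous (D i)) ->
  (forall (g : X -> R) (e : R), continuous g -> 0 < e ->
    exists i, forall x, `|g x - D i x| <= e) ->
  traces f M r t q x z ->
  (forall i m, exists k c, [/\ (m <= k)%N, (k.+1 * start k <= c)%N,
     (start k + c <= t k.+1)%N & weak_ball D i nu (empirical f (x k) c)]) ->
  V_ f z nu.
Proof.
move=> cD dD zx H; apply/(V_weak_ball X_compact f cD dD) => i m.
pose i' := i.*2.+1.
have [k0 k0P] : exists k0, forall k c, (k0 <= k)%N -> (k.+1 * start k <= c)%N ->
    (start k + c <= t k.+1)%N ->
    weak_ball D i' (empirical f (x k) c) (empirical f z (start k + c)).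
  rewrite /weak_ball; elim: {-2}i' => [|n [k1 k1P]]; first by exists 0%N.
  have [|k2 k2P] := @shadow_mean q x z (D n) i'.+1%:R^-1 zx (cD n).
    by rewrite invr_gt0.
  exists (maxn k1 k2) => k c; rewrite geq_max => /andP[k1k k2k] ac ct j.
  by rewrite ltnS leq_eqVlt => /predU1P[->|]; [exact: k2P|exact: k1P].
have [k [c [+ ac ct nuc]]] := H i' (maxn m k0); rewrite geq_max => /andP[mk k0k].
exists (start k + c)%N.
  by rewrite (leq_trans mk)// (leq_trans (start_ge k))// leq_addr.
apply: (weak_ball_triangle (k' := i')) (leqnn _) nuc _.
by apply: weak_ball_sym; exact: k0P.
Qed.

End OrbitSums.

(** * Distributional chaos *)

Section Scrambling.
Context {R : realType} {X : pmetricType R}.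
Variable f : X -> X.

Lemma card_tail_ge (n a : nat) (P : pred nat) :
  (forall j, (a <= j < n)%N -> P j) -> (n - a <= #|[set j : 'I_n | P j]%SET|)%N.
Proof.
move=> aP; rewrite cardsE cardE /enum_mem -enumT size_filter.
rewrite -(count_map val P) val_enum_ord.
have [na|an] := leqP n a; first by rewrite (eqP na).
rewrite -{2}(subnKC (ltnW an)) iotaD count_cat add0n.
rewrite (_ : count P (iota a _) = n - a)%N ?leq_addl//.
apply/eqP; rewrite -{2}(size_iota a (n - a)) -all_count.
by apply/allP => j; rewrite mem_iota subnKC ?(ltnW an)//; exact: aP.
Qed.

Lemma card_head_le (n a : nat) (P : pred nat) :
  (forall j, (a <= j < n)%N -> ~~ P j) -> (#|[set j : 'I_n | P j]%SET| <= a)%N.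
Proof.
move=> aP; have := @card_tail_ge n a (predC P) aP.
rewrite leq_subLR -{1}[n]card_ord -(cardsC [set j : 'I_n | P j]%SET).
rewrite (_ : ~: [set j : 'I_n | P j]%SET = [set j : 'I_n | ~~ P j]%SET)%SET.
  by rewrite leq_add2r.
by apply/setP => j; rewrite !inE.
Qed.

Variables (M : nat -> R -> nat) (r : R) (t : nat -> nat).
Hypothesis M_spec : non_uniform_specification f M.
Hypothesis r_gt0 : 0 < r.
Hypothesis t_start : forall k, (start M r t k <= t k.+1)%N.
Hypothesis t_long : forall k, (k.+1 * start M r t k <= t k.+1)%N.
Local Notation start := (start M r t).
Local Notation err := (err r).

Lemma start_ratio (e : R) (N : nat) : 0 < e ->
  exists m, forall k, (m <= k)%N -> (N <= t k.+1)%N /\ (start k)%:R <= e * (t k.+1)%:R.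
Proof.
move=> e0; exists (maxn N (Num.truncn e^-1)) => k; rewrite geq_max => /andP[Nk ek].
split; first by rewrite (leq_trans Nk)// (leq_trans _ (t_ge M_spec r_gt0 t_start _)).
rewrite -ler_pdivrMl// (@le_trans _ _ (k.+1%:R * (start k)%:R))//.
  by rewrite ler_wpM2r// ltW// (lt_le_trans (truncnS_gt _))// ler_nat.
by rewrite -natrM ler_nat.
Qed.

(** At time [t k.+1] nearly all of the past lies in block [k], so the frequencies are those of the
    targets: equal targets give frequency near 1, separated ones frequency near 0. *)
Lemma traces_DC1 q x x' z z' : traces f M r t q x z -> traces f M r t q x' z' ->
  (forall m, exists2 k, (m <= k)%N & x k = x' k) ->
  (exists2 d : R, 0 < d & forall m, exists2 k, (m <= k)%N &
    forall j, d <= mdist (iter j f (x k)) (iter j f (x' k))) ->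
  DC1_pair f z z'.
Proof.
move=> zx zx' xx' [d d0 dxx'].
have t0 k : 0 < (t k.+1)%:R :> R.
  by rewrite ltr0n (leq_trans _ (t_ge M_spec r_gt0 t_start _)).
have tr k j : (start k <= j < t k.+1)%N ->
    mdist (iter (j - start k) f (x k)) (iter j f z) <= err k /\
    mdist (iter (j - start k) f (x' k)) (iter j f z') <= err k.
  move=> /andP[kj jk]; have [_ H] := zx; have [_ H'] := zx'.
  by split; [apply: H|apply: H']; rewrite kj ltnW.
split=> [s s0|].
  have s20 : 0 < s / 2 by rewrite divr_gt0.
  apply: limn_esup_eq1 => [n|e N e0].
    rewrite /close_freq lee_fin; case: n => [|n]; first by rewrite invr0 mulr0.
    by rewrite ler_pdivrMr// mul1r ler_nat (leq_trans (max_card _))// card_ord.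
  have [m mP] := start_ratio N e0; have [m' m'P] := err_small r_gt0 s20.
  have [k + xk] := xx' (maxn m m'); rewrite geq_max => /andP[mk m'k].
  have [Nk ek] := mP k mk; exists (t k.+1) => //.
  rewrite lee_fin ler_pdivlMr// mulrBl mul1r lerBlDr.
  rewrite (@le_trans _ _ ((t k.+1 - start k)%:R + (start k)%:R))//.
    by rewrite -natrD subnK.
  rewrite lerD// ler_nat; apply: (@card_tail_ge _ _ (fun j => mdist (iter j f z) (iter j f z') < s)).
  move=> j /tr[h h']; rewrite (le_lt_trans (metric_triangle _ (iter (j - start k) f (x k)) _))//.
  rewrite [in ltRHS](splitr s) ltrD//.
    by rewrite metric_sym (le_lt_trans h)// m'P.
  by rewrite xk (le_lt_trans h')// m'P.
(* Two tracing errors below [d / 4] leave the orbits at least [d / 2] apart on the block. *)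
have d40 : 0 < d / 4 by rewrite divr_gt0.
exists (d / 4) => //; apply: limn_einf_eq0 => [n|e N e0].
  by rewrite lee_fin divr_ge0.
have [m mP] := start_ratio N e0; have [m' m'P] := err_small r_gt0 d40.
have [k + xk] := dxx' (maxn m m'); rewrite geq_max => /andP[mk m'k].
have [Nk ek] := mP k mk; exists (t k.+1) => //.
rewrite lee_fin ler_pdivrMr// (le_trans _ ek)// ler_nat.
apply: (@card_head_le _ _ (fun j => mdist (iter j f z) (iter j f z') < d / 4)).
move=> j /tr[h h']; rewrite -leNgt.
have := xk (j - start k)%N; have ek4 := m'P k m'k.
have := metric_triangle (iter (j - start k) f (x k)) (iter j f z) (iter (j - start k) f (x' k)).
have := metric_triangle (iter j f z) (iter j f z') (iter (j - start k) f (x' k)).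
rewrite (metric_sym (iter j f z') (iter _ f (x' k))).
lra.
Qed.

End Scrambling.

(** * Mass carried by the gaps *)

Section GapMass.
Context {R : realType} {X : pmetricType R}.
Hypothesis X_compact : compact [set: X].
Variable f : X -> X.
Variable D : nat -> X -> R.
Hypothesis D_continuous : forall i, continuous (D i).
Hypothesis D_dense : forall (g : X -> R) (e : R), continuous g -> 0 < e ->
  exists i, forall x, `|g x - D i x| <= e.
Variables (M : nat -> R -> nat) (r tau : R) (t : nat -> nat).
Hypothesis M_spec : non_uniform_specification f M.
Hypothesis r_gt0 : 0 < r.
Hypothesis tau_ge0 : 0 <= tau.
Hypothesis t_start : forall k, (start M r t k <= t k.+1)%N.
Hypothesis t_long : forall k, (k.+1 * start M r t k <= t k.+1)%N.
Hypothesis t_gap : forall k,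
  (start M r t k.+1 - t k.+1)%:R <= (tau + k.+1%:R^-1) * (t k.+1).+1%:R.
Local Notation start := (start M r t).
Local Notation err := (err r).
Variables (A : set (borel_prob X)) (q x : nat -> X) (z : X).
Hypothesis z_traces : traces f M r t q x z.
(** A stretch shorter than about [t k.+1 / k.+1] has negligible weight and is left uncontrolled. *)
Hypothesis x_near : forall k m, (t k.+1 <= k.+1 * m)%N ->
  thickening D k A (empirical f (x k) m) /\ thickening D k A (empirical f (x k.+1) m).

(* In p, the three weights are those of the gap between the blocks k and k.+1,
   of the block k and of the block k.+1; the measures come in the same order. *)
Definition decomposes (n k : nat)
    (p : (R * R * R) * (borel_prob X * borel_prob X * borel_prob X)) : Prop :=
  let: ((a, b, c), (lam, mu1, mu2)) := p in
  [/\ [/\ 0 <= a, 0 <= b & 0 <= c],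
      [/\ a + b + c <= 1, 1 - k.+1%:R^-1 <= a + b + c &
        a * (1 + tau + k.+1%:R^-1) <= tau + k.+1%:R^-1],
      thickening D k A mu1, thickening D k A mu2 &
      forall g (B e : R), continuous g -> (forall y, `|g y| <= B) ->
        (forall u v, mdist u v <= err k -> `|g u - g v| <= e) ->
        `|mean (empirical f z n) g - (a * mean lam g + b * mean mu1 g + c * mean mu2 g)|
          <= e + 5 * B * k.+1%:R^-1].

(** The times up to [n] split into a prefix of length [a], block [k], a gap of length [l] and the
    first [m] times of block [k.+1]. The prefix is dropped, as [t_long] makes it negligible. The gap
    weight is bounded through [l <= (tau + 1 / k.+1) * b.+1] and [b.+1 + l <= n.+1]. *)
Lemma decomposition n k : (0 < k)%N -> (t k.+1 <= n < t k.+2)%N ->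
  exists p, decomposes n k p.
Proof.
move=> k0 /andP[bn nt].
set b := t k.+1 in bn; set a := start k; set a' := start k.+1.
have ab : (a <= b)%N := t_start k.
have ka : (k.+1 * a <= b)%N := t_long k.
have kb : (k.+1 <= b)%N := t_ge M_spec r_gt0 t_start k.+1.
have ba' : (b < a')%N.
  exact: ltn_trans (visit_gt M_spec t r_gt0 k.+1) (start_gt M_spec t r_gt0 k.+1).
pose l := (minn n.+1 a' - b.+1)%N; pose m := (n.+1 - a')%N.
have nE : n.+1 = (a + (b - a).+1 + l + m)%N by rewrite /l /m; lia.
have lE : (0 < m)%N -> (b.+1 + l)%N = a' by rewrite /l /m; lia.
have abE : (a + (b - a).+1 = b.+1)%N by rewrite addnS subnKC.
have blN : (b.+1 + l <= n.+1)%N by rewrite /l; lia.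
have la' : (l <= a' - b)%N by rewrite /l; lia.
have ajb j : (j < (b - a).+1)%N -> (a + j <= b)%N by lia.
have a'jt j : (j < m)%N -> (a' + j <= t k.+2)%N by rewrite /m; lia.
(* If block [k.+1] has been followed long enough, its empirical measure is near [A]. Otherwise its
   weight is at most [2 / k.+1], and [mu1] serves as a substitute. The predecessors appear because
   [empirical] at index [n] averages [n.+1] points. *)
pose far := (b <= k.+1 * m.-1)%N.
have far_m : far -> (0 < m)%N.
  by rewrite /far; case: (m) => //; rewrite muln0 leqn0 => /eqP b0; rewrite b0 in kb.
have near_m : ~~ far -> (m * k.+1 <= 2 * n.+1)%N.
  rewrite -ltnNge => bm; have /leq_trans : (m * k.+1 <= k.+1 + k.+1 * m.-1)%N.
    by rewrite -mulnS mulnC leq_mul2l leqSpred orbT.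
  by apply; lia.
pose mu1 : borel_prob X := empirical f (x k) (b - a).
pose lam : borel_prob X := empirical f (iter b.+1 f z) l.-1.
pose mu2 : borel_prob X :=
  if far then (empirical f (x k.+1) m.-1 : borel_prob X) else mu1.
have N0 : 0 < n.+1%:R :> R by rewrite ltr0n.
have k0r : 0 < k.+1%:R :> R by rewrite ltr0n.
have mu1A : thickening D k A mu1.
  (* Here [0 < k] gives [k.+1 * b >= 2 * b], of which at most [b] is lost with [k.+1 * a]. *)
  apply: (x_near (k := k) (m := b - a) _).1; rewrite -/b mulnBr.
  have : (b + b <= k.+1 * b)%N by rewrite addnn -mul2n leq_mul2r ltnS k0 orbT.
  by move: (k.+1 * b)%N ka => kb' ka; lia.
exists ((l%:R / n.+1%:R, (b - a).+1%:R / n.+1%:R, m%:R / n.+1%:R), (lam, mu1, mu2)).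
have NE : n.+1%:R = a%:R + (b - a).+1%:R + l%:R + m%:R :> R by rewrite nE !natrD.
have aN : a%:R <= k.+1%:R^-1 * n.+1%:R :> R.
  by rewrite mulrC ler_pdivlMr// -natrM ler_nat mulnC (leq_trans ka)// (leq_trans bn).
split => //.
- have sE : l%:R / n.+1%:R + (b - a).+1%:R / n.+1%:R + m%:R / n.+1%:R =
      1 - a%:R / n.+1%:R :> R.
    by rewrite -!mulrDl -[X in X - _](divff (lt0r_neq0 N0)) -mulrBl NE; congr (_ / _); ring.
  rewrite sE; split.
  + by rewrite gerBl divr_ge0.
  + by rewrite lerD2l lerN2 ler_pdivrMr.
  + rewrite mulrAC ler_pdivrMr//.
    have /(_ k) := t_gap; rewrite -/b -/a'.
    have lb : l%:R <= (a' - b)%:R :> R by rewrite ler_nat.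
    have Nb : b.+1%:R + l%:R <= n.+1%:R :> R by rewrite -natrD ler_nat.
    have T0 : 0 <= tau + k.+1%:R^-1 by rewrite addr_ge0// invr_ge0 ltW.
    rewrite -addrA; move: (tau + k.+1%:R^-1) T0 => T T0 hb.
    have := ler_wpM2l T0 Nb; lra.
- rewrite /mu2; case: (boolP far) => // bm.
  exact: (x_near (k := k) (m := m.-1) bm).2.
move=> g B e cg gB ge.
have B0 : 0 <= B by exact: le_trans (gB z).
have e0 : 0 <= e.
  by rewrite (le_trans _ (ge z z _))// mdistxx ltW// err_gt0.
pose Sa := orbit_sum f g z a; pose Sb := orbit_sum f g (iter a f z) (b - a).+1.
pose Sm := orbit_sum f g (iter (b.+1 + l) f z) m.
pose Sx := orbit_sum f g (x k) (b - a).+1.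
have SE : orbit_sum f g z n.+1 = Sa + Sb + l%:R * mean lam g + Sm.
  by rewrite nE 3!orbit_sumD abE -orbit_sum_mean.
have SxE : Sx = (b - a).+1%:R * mean mu1 g by rewrite /Sx orbit_sum_mean.
have Sab : `|Sa| <= a%:R * B by exact: orbit_sum_bounded.
have Sbx : `|Sb - Sx| <= (b - a).+1%:R * e.
  rewrite distrC; apply: orbit_sum_dist => j jb; apply: ge.
  by apply: (traces_dist z_traces); exact: ajb.
(* The 4 is twice the weight bound 2, for the sum and for its substitute; the dropped prefix adds 1,
   hence the 5 in [decomposes]. *)
have Smb : `|Sm - m%:R * mean mu2 g| <= m%:R * e + 4 * B * k.+1%:R^-1 * n.+1%:R.
  rewrite /mu2; case: (boolP far) => [bm|].
    have m0 := far_m bm.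
    rewrite -orbit_sum_mean// (@le_trans _ _ (m%:R * e))//; last first.
      by rewrite lerDl !mulr_ge0 ?invr_ge0 ?(ltW k0r) ?(ltW N0).
    rewrite distrC; apply: orbit_sum_dist => j jm; apply: ge.
    rewrite lE// (le_trans (traces_dist z_traces _)) ?err_le//.
    exact: a'jt.
  move=> bm; have mN : m%:R <= 2 * k.+1%:R^-1 * n.+1%:R :> R.
    by rewrite mulrAC ler_pdivlMr// -!natrM ler_nat near_m.
  have := orbit_sum_bounded f (iter (b.+1 + l) f z) m gB; rewrite -/Sm => h1.
  have h2 : `|m%:R * mean mu1 g| <= m%:R * B.
    by rewrite normrM normr_nat ler_wpM2l// mean_bounded.
  rewrite (le_trans (ler_normB _ _))// (le_trans (lerD h1 h2))//.
  have := ler_wpM2r B0 mN; have : 0 <= m%:R * e by exact: mulr_ge0.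
  by move: (m%:R) (k.+1%:R^-1) (n.+1%:R) => m' c N; lra.
rewrite mean_empirical// SE.
have -> : (Sa + Sb + l%:R * mean lam g + Sm) / n.+1%:R -
    (l%:R / n.+1%:R * mean lam g + (b - a).+1%:R / n.+1%:R * mean mu1 g +
     m%:R / n.+1%:R * mean mu2 g) =
    (Sa + (Sb - Sx) + (Sm - m%:R * mean mu2 g)) / n.+1%:R.
  by rewrite SxE; field; rewrite lt0r_neq0.
rewrite normrM normfV (gtr0_norm N0) ler_pdivrMr//.
rewrite (le_trans (ler_normD _ _))// (le_trans (lerD (ler_normD _ _) Smb))//.
rewrite (le_trans (lerD (lerD Sab Sbx) (lexx _)))//.
have := ler_wpM2r B0 aN; have : 0 <= a%:R * e by exact: mulr_ge0.
have : 0 <= l%:R * e by exact: mulr_ge0.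
have -> : (e + 5 * B * k.+1%:R^-1) * n.+1%:R =
  a%:R * e + (b - a).+1%:R * e + l%:R * e + m%:R * e + 5 * B * k.+1%:R^-1 * n.+1%:R.
  by rewrite mulrDl {1}NE; ring.
move: (a%:R) (m%:R) (l%:R) ((b - a).+1%:R) (k.+1%:R^-1) (n.+1%:R) => a1 m1 l1 b1 c N.
lra.
Qed.

(** Along one ultrafilter of times the empirical measures tend to [nu] and all weights and measures
    of the decompositions converge. In the limit the weights sum to 1, the gap weight satisfies
    [la * (1 + tau) <= tau], the block measures lie in the closure of [A], and [tv_dist_mixture]
    applies. *)
Lemma gap_mass_bound nu : V_ f z nu ->
  exists2 mu, closed_convex_hull A mu & (tv_dist mu nu <= (tau / (1 + tau))%:E)%E.
Proof.
move=> /(V_weak_ball X_compact f D_continuous D_dense z nu) znu.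
have tge := t_ge M_spec r_gt0 t_start.
have tle := t_le M_spec r_gt0 t_start.
pose em n : borel_prob X := empirical f z n.
have /choice[p pP] : forall n, exists p : nat * ((R * R * R) *
    (borel_prob X * borel_prob X * borel_prob X)), (t 2 <= n)%N ->
    (n < t p.1.+2)%N /\ decomposes n p.1 p.2.
  move=> n; have [n2|n2] := leqP (t 2) n; last first.
    (* A dummy value: times below [t 2] are outside the filter used. *)
    by exists (0%N, (0, 0, 0, (em 0%N, em 0%N, em 0%N))).
  have ub i : (t i <= n)%N -> (i <= n)%N by move=> /(leq_trans (tge i)).
  (* The last [i] with [t i <= n] is at least 2; its predecessor is the positive index of the
     block. *)
  have [i ti imax] := ex_maxnP (ex_intro _ 2%N n2) ub.
  have i2 := imax _ n2.
  have ni : (n < t i.+1)%N by rewrite ltnNge; apply/negP => /imax; rewrite ltnn.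
  case: i i2 ti ni {imax} => [//|k] k0 tk nk.
  have [|d dP] := @decomposition n k k0; first by rewrite tk.
  by exists (k, d).
pose near i := [set n | (i <= n)%N /\ weak_ball D i nu (em n)].
have G0P : ProperFilter (filter_from [set: nat] near).
  apply: filter_from_proper; last first.
    by move=> i _; have [n ? ?] := znu i i; exists n.
  apply: filter_from_filter; first by exists 0%N.
  move=> i j _ _; exists (maxn i j) => // n [+ H]; rewrite geq_max => /andP[hi hj].
  by split; split=> //; apply: weak_ballS H; rewrite ?leq_maxl ?leq_maxr.
have [G [GU G0G]] := ultraFilterLemma G0P.
have GP : ProperFilter G by exact: ultra_proper.
have Gge m : G [set n | (m <= n)%N] by apply: G0G; exists m => // n [].
have emG : em @ G --> nu.
  move=> O /(weak_ball_base X_compact D_continuous D_dense)[k kO].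
  by apply: G0G; exists k => // n [_]; exact: kO.
have Gp m : G [set n | decomposes n (p n).1 (p n).2 /\ (m <= (p n).1)%N].
  apply: filterS (Gge (t (maxn 2 m.+1))) => n /= n2m.
  have [|np ?] := pP n; first by rewrite (leq_trans _ n2m)// tle// leq_maxl.
  split=> //; rewrite leqNgt; apply/negP => pm; move: np; rewrite ltnNge => /negP; apply.
  by apply: leq_trans n2m; apply: tle; apply: leq_trans (leq_maxr _ _).
have small (e : R) : 0 < e -> G [set n | ((p n).1).+1%:R^-1 <= e].
  move=> e0; apply: filterS (Gp (Num.truncn e^-1)) => n [_ en].
  rewrite /= invf_ple ?posrE ?ltr0n// ltW// (lt_le_trans (truncnS_gt _))//.
  by rewrite ler_nat.
pose a n := (p n).2.1.1.1; pose b n := (p n).2.1.1.2; pose c n := (p n).2.1.2.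
pose lam n := (p n).2.2.1.1; pose mu1 n := (p n).2.2.1.2; pose mu2 n := (p n).2.2.2.
have GP' (Q : nat -> Prop) : (forall n, decomposes n (p n).1 (p n).2 -> Q n) -> G Q.
  by move=> H; apply: filterS (Gp 0%N) => n [/H].
have dE n : (p n).2 = ((a n, b n, c n), (lam n, mu1 n, mu2 n)).
  by rewrite /a /b /c /lam /mu1 /mu2; case: (p n).2 => [[[? ?] ?] [[? ?] ?]].
have cvg01 (u : nat -> R) : G [set n | 0 <= u n <= 1] ->
    exists2 l : R, 0 <= l & u @ G --> l.
  move=> u01; have [|l] := @ultra_cvg _ R G `[0, 1]%classic u GU (@segment_compact _ _ _).
    by apply: filterS u01 => n /=; rewrite in_itv.
  by rewrite /= in_itv/= => /andP[l0 _] ul; exists l.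
have [la la0 aG] : exists2 l : R, 0 <= l & a @ G --> l.
  apply: cvg01; apply: GP' => n; rewrite dE => -[[? ? ?] [? _ _] _ _ _] /=.
  by apply/andP; split; lra.
have [lb lb0 bG] : exists2 l : R, 0 <= l & b @ G --> l.
  apply: cvg01; apply: GP' => n; rewrite dE => -[[? ? ?] [? _ _] _ _ _] /=.
  by apply/andP; split; lra.
have [lc lc0 cG] : exists2 l : R, 0 <= l & c @ G --> l.
  apply: cvg01; apply: GP' => n; rewrite dE => -[[? ? ?] [? _ _] _ _ _] /=.
  by apply/andP; split; lra.
have cvg_sub u : exists m : borel_prob X, (u : nat -> borel_prob X) @ G --> m.
  have [|m _ um] := ultra_cvg GU (borel_prob_compact X_compact) (u := u).
    exact: filterT.
  by exists m.
have [llam lamG] := cvg_sub lam; have [lmu1 mu1G] := cvg_sub mu1; have [lmu2 mu2G] := cvg_sub mu2.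
have abcG : a n + b n + c n @[n --> G] --> la + lb + lc by apply: cvgD => //; exact: cvgD.
have labc : la + lb + lc = 1.
  apply/eqP; rewrite eq_le; apply/andP; split.
    apply: (ler_cvg_to abcG (cvg_cst (1 : R))).
    by apply: GP' => n; rewrite dE => -[_ []].
  apply/ler_addgt0Pr => e e0; rewrite -lerBlDr.
  apply: (ler_cvg_to (cvg_cst (1 - e)) abcG).
  apply: filterS2 (small e e0) (Gp 0%N) => n ne [].
  rewrite dE => -[_ [_ + _] _ _ _] _; apply: le_trans.
  by rewrite lerD2l lerN2.
have latau : la * (1 + tau) <= tau.
  apply/ler_addgt0Pr => e e0.
  apply: (ler_cvg_to (cvgM aG (cvg_cst (1 + tau))) (cvg_cst (tau + e))).
  apply: filterS2 (small e e0) (Gp 0%N) => n ne [].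
  rewrite dE => -[[a0 _ _] [_ _ h] _ _ _] _.
  have : 0 <= a n * ((p n).1).+1%:R^-1 by rewrite mulr_ge0// invr_ge0.
  have ne' : ((p n).1).+1%:R^-1 <= e by exact: ne.
  change (0 <= a n * ((p n).1).+1%:R^-1 -> a n * (1 + tau) <= tau + e).
  by move: h ne'; move: (((p n).1).+1%:R^-1) => i; lra.
have tau1 : 0 < 1 + tau by rewrite ltr_wpDr.
have latau' : la <= tau / (1 + tau) by rewrite ler_pdivlMr.
have la1 : la < 1.
  by rewrite (le_lt_trans latau')// ltr_pdivrMr// mul1r ltrDr.
have nearG (u : nat -> borel_prob X) m : (forall n, decomposes n (p n).1 (p n).2 ->
    thickening D (p n).1 A (u n)) -> u @ G --> m -> closure A m.
  move=> uA; apply: (closure_thickening X_compact D_continuous D_dense (k := fun n => (p n).1)).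
    by move=> m'; apply: filterS (Gp m') => n [].
  exact: GP'.
have A1 : closure A lmu1 by apply: nearG mu1G => n; rewrite dE => -[].
have A2 : closure A lmu2 by apply: nearG mu2G => n; rewrite dE => -[].
have [|mu muA munu] := tv_dist_mixture X_compact D_continuous D_dense la0 lb0 lc0 labc la1 A1 A2
  (lam := llam) (nu := nu); last first.
  by exists mu => //; rewrite (le_trans munu)// lee_fin.
move=> g cg; apply/eqP; rewrite -subr_eq0 -normr_le0; apply/ler_addgt0Pr => e e0.
have [B B0 gB] := continuous_bounded X_compact cg.
have meanG (u : nat -> borel_prob X) m : u @ G --> m -> mean (u n) g @[n --> G] --> mean m g.
  by move=> um; have /weak_cvgP/(_ g cg) := um; exact.
rewrite add0r.
have hG : (fun n => `|mean (em n) g -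
    (a n * mean (lam n) g + b n * mean (mu1 n) g + c n * mean (mu2 n) g)|) @ G -->
    `|mean nu g - (la * mean llam g + lb * mean lmu1 g + lc * mean lmu2 g)|.
  apply: cvg_norm; apply: cvgB; first exact: meanG.
  by apply: cvgD; [apply: cvgD|]; apply: cvgM => //; exact: meanG.
apply: (ler_cvg_to hG (cvg_cst e)).
have e20 : 0 < e / 2 by rewrite divr_gt0.
have [d d0 gd] := uniformly_continuous X_compact cg e20.
have [m mP] := err_small r_gt0 d0.
have eB : 0 < e / 2 / (5 * B) by rewrite !divr_gt0// mulr_gt0.
apply: filterS2 (small _ eB) (Gp m) => n ne [+ mn].
rewrite dE => -[_ _ _ _ /(_ g B (e / 2) cg gB)] H.
rewrite (le_trans (H _))//.
  by move=> u v uv; apply/ltW/gd; rewrite (le_lt_trans uv)// mP.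
rewrite [leRHS](splitr e) lerD2l -ler_pdivlMl ?mulr_gt0//.
by rewrite mulrC.
Qed.

End GapMass.

(** * An uncountable family of points *)

(** This makes the coding of points by 0-1 sequences injective: for equal points the frequency is
    constantly 1. *)
Lemma DC1_pair_neq (R : realType) (X : pmetricType R) (f : X -> X) (x y : X) :
  DC1_pair f x y -> x <> y.
Proof.
move=> [_ [s s0 liminf0]] xy; move: liminf0; rewrite -xy => liminf0.
have [|[//|n] _] := @limn_einf_lt R (close_freq f x x s) 1%E 1; first by rewrite liminf0 lte01.
rewrite /close_freq (eq_card (B := predT)) ?card_ord ?divff ?pnatr_eq0 ?ltxx// => j.
by rewrite !inE mdistxx s0.
Qed.

(** The 2-adic valuation takes the value [v] at every odd multiple of [2 ^ v]. *)
Lemma value_infinitely_often : exists g : nat -> nat,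
  forall v m, exists2 k, (m <= k)%N & g k = v.
Proof.
exists (fun k => logn 2 k.+1) => v m; exists (2 ^ v * m.*2.+1).-1.
  by have := leq_pmull m.*2.+1 (expn_gt0 2 v); lia.
rewrite prednK ?muln_gt0 ?expn_gt0// lognM ?expn_gt0// pfactorK// logn_coprime ?addn0//.
by rewrite coprime2n /= odd_double.
Qed.

(** Cantor's diagonal argument, with [dec] as a left inverse of the enumeration. *)
Lemma uncountable_range (T : choiceType) (z : (nat -> bool) -> T) :
  injective z -> ~ countable (range z).
Proof.
move=> z_inj /countable_injP[h h_inj].
have hz_inj : injective (h \o z).
  by move=> a b /h_inj H; apply: z_inj; apply: H; rewrite inE; [exists a|exists b].
pose dec i := xget (fun=> true) [set a | h (z a) = i].
pose diag i := ~~ dec i i.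
have H : [set a | h (z a) = h (z diag)] (dec (h (z diag))).
  by apply: (@xgetI _ _ _ diag).
have : dec (h (z diag)) = diag by exact: hz_inj.
move=> /(congr1 (fun a => a (h (z diag)))) /esym.
by rewrite {1}/diag; case: (dec _ _).
Qed.

Theorem theorem4 (R : realType) (X : pmetricType R) (f : X -> X) (tau : R)
    (K L : set (borel_prob X)) (p0 p1 : X)
    (X_compact : compact [set: X])
    (X_two_points : exists x y : X, x <> y)
    (f_continuous : continuous f)
    (tau_ge0 : 0 <= tau)
    (f_spec : non_uniform_tau_specification f tau)
    (K_nonempty : K !=set0) (K_closed : closed_in_invariant f K)
    (L_nonempty : L !=set0) (L_closed : closed_in_invariant f L)
    (KL_disjoint : K `&` L = set0)
    (p_distal : distal_pair f p0 p1)
    (K_union : exists (I : Type) (K_ : I -> set (borel_prob X)),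
       K = \bigcup_i K_ i /\
       forall i, [/\ K_ i !=set0, connected (K_ i),
                     closed_in_invariant f (K_ i) & Geq f (K_ i) !=set0])
    (KL_far : forall mu nu : borel_prob X,
       closed_convex_hull (K `|` V_ f p0 `|` V_ f p1) mu -> L nu ->
       ((tau / (1 + tau))%:E < tv_dist mu nu)%E) :
  forall U : set X, open U -> U !=set0 ->
    exists S : set X,
      [/\ ~ countable S, DC1_scrambled f S &
          S `<=` (Gsup f K `&` U `&` Trans f)
                 `\` \bigcup_(nu in L) Gsup f [set nu]].
Proof.
move=> U oU [u0 Uu0].
have [[M M_spec M_rate] _] := f_spec.
have [D [D_continuous D_dense]] := dense_continuous X_compact.
have [qd qd_dense] := dense_sequence X_compact.
have [m [Km m_dense]] := dense_measures D K_nonempty.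
(* [y j] is a point of [Geq f] for a piece of [K] containing [m j]. *)
have /choice[y yP] : forall j, exists y, V_ f y (m j) /\ V_ f y `<=` K.
  move=> j; have [I [K_ [KE KP]]] := K_union.
  have := Km j; rewrite KE => -[i _ Kij].
  have [_ _ _ [y yE]] := KP i; exists y; rewrite yE; split=> //.
  by move=> nu Knu; exists i.
have [g gP] := value_infinitely_often.
have [r r0 rU] : exists2 r : R, 0 < r & forall v, mdist u0 v <= r -> U v.
  have /nbhs_mdist[e e0 eU] : nbhs u0 U by exact: open_nbhs_nbhs.
  exists (e / 2); first by rewrite divr_gt0.
  by move=> v uv; apply: eU; rewrite (le_lt_trans uv)// gtr_pMr// invf_lt1 ?ltr1n.
pose A := K `|` V_ f p0 `|` V_ f p1.
(* Blocks [2k] and [2k+1] share the index [g k], each value of which recurs forever: it selects a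
   measure for the even block and a bit for the odd one. *)
pose Y k := y (g k./2).
pose x (xi : nat -> bool) k :=
  if odd k then (if xi (g k./2) then p1 else p0) else Y k.
have YA k : V_ f (Y k) `<=` A.
  by move=> nu /(yP (g k./2)).2 Knu; left; left.
(* The four cases cover the targets of blocks [k] and [k.+1] for every [xi], so that the times [t]
   are common to all sequences and the points can be compared block by block. *)
have /choice[n0 n0P] : forall k, exists n0, forall n, (n0 <= n)%N ->
    forall v, [\/ v = Y k, v = Y k.+1, v = p0 | v = p1] ->
      thickening D k A (empirical f v n).
  move=> k.
  have near v : V_ f v `<=` A -> exists n0, forall n, (n0 <= n)%N ->
      thickening D k A (empirical f v n).
    by move=> vA; apply: (empirical_thickening X_compact D_continuous).
  have [n1 n1P] := near _ (YA k); have [n2 n2P] := near _ (YA k.+1).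
  have [n3 n3P] : exists n0, forall n, (n0 <= n)%N -> thickening D k A (empirical f p0 n).
    by apply: near => nu; left; right.
  have [n4 n4P] : exists n0, forall n, (n0 <= n)%N -> thickening D k A (empirical f p1 n).
    by apply: near => nu; right.
  exists (maxn (maxn n1 n2) (maxn n3 n4)) => n; rewrite !geq_max.
  by move=> /andP[/andP[? ?] /andP[? ?]] v [->|->|->|->]; auto.
have /choice[C CP] : forall p : nat * nat, exists c, (p.1.+1 * p.2 <= c)%N /\
    weak_ball D p.1 (m (g p.1./2)) (empirical f (Y p.1) c).
  move=> [k a]; have [H _] := yP (g k./2).
  have [c ? ?] := (V_weak_ball X_compact f D_continuous D_dense _ _).1 H k (k.+1 * a)%N.
  by exists c.
(* The three thresholds make block [k] dominate its past, contain the time at which [Y k] is near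
   its measure, and exceed [k.+1 * n0 k] as [x_near] demands. *)
have [t tP] := times_exist M_rate
  (fun k a => maxn (k.+1 * a) (maxn (a + C (k, a)) (k.+1 * n0 k))) r0.
have t_start k : (start M r t k <= t k.+1)%N by have [] := tP k.
have t_gap k : (start M r t k.+1 - t k.+1)%:R <= (tau + k.+1%:R^-1) * (t k.+1).+1%:R.
  by have [] := tP k.
have [t_long t_C t_n0] : [/\ forall k, (k.+1 * start M r t k <= t k.+1)%N,
    forall k, (start M r t k + C (k, start M r t k) <= t k.+1)%N &
    forall k, (k.+1 * n0 k <= t k.+1)%N].
  by split=> k; have [_ + _] := tP k; rewrite !geq_max => /and3P[].
have /choice[z zP] : forall xi, exists z, mdist u0 z <= r /\
    traces f M r t (fun k => qd (g k)) (x xi) z.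
  move=> xi; have [z ? ?] := tracing_point X_compact f_continuous M_spec r0 t_start
    u0 (fun k => qd (g k)) (x xi).
  by exists z.
have x_even xi k : ~~ odd k -> x xi k = Y k by rewrite /x => /negbTE ->.
have zDC1 xi xi' : xi <> xi' -> DC1_pair f (z xi) (z xi').
  move=> neq; have [i xii'] : exists i, xi i <> xi' i.
    by apply/existsNP => H; apply: neq; exact/funext.
  apply: (traces_DC1 M_spec r0 t_start t_long (zP xi).2 (zP xi').2) => [n|].
    exists n.*2; first by rewrite -addnn leq_addr.
    by rewrite !x_even ?odd_double.
  exists (inf (range (fun n => mdist (iter n f p0) (iter n f p1)))) => // n.
  (* The odd blocks reading bit [i] have targets [p0] and [p1] in some order, which stay apart by
     distality. *)
  have [k nk gk] := gP i n; exists k.*2.+1; first by rewrite (leq_trans nk)//; lia.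
  have lb j : inf (range (fun n => mdist (iter n f p0) (iter n f p1))) <=
      mdist (iter j f p0) (iter j f p1).
    apply: ge_inf; last by exists j.
    by exists 0 => _ [j' _ <-]; exact: mdist_ge0.
  move=> j; rewrite /x /= odd_double/= uphalf_double gk.
  by case: (xi i) (xi' i) xii' => [] [] // _; rewrite // metric_sym.
exists (range z); split.
- apply: uncountable_range => xi xi' zz; apply: contrapT => neq.
  exact: DC1_pair_neq (zDC1 _ _ neq) zz.
- move=> _ _ [xi _ <-] [xi' _ <-] zneq; apply: zDC1 => xixi'.
  by apply: zneq; rewrite xixi'.
move=> _ [xi _ <-]; have [u0z ztr] := zP xi; split; [split; [split|]|].
- move=> nu Knu; apply: (shadow_V X_compact M_spec r0 t_start D_continuous D_dense ztr).
  (* A measure [m j] near [nu] is realised on the even blocks [2k] with [g k = j]. *)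
  move=> i n; have [j nuj] := m_dense nu Knu i.*2.+1.
  have [k ik gk] := gP j (maxn i.*2.+1 n).
  move: ik; rewrite geq_max => /andP[ik nk].
  exists k.*2, (C (k.*2, start M r t k.*2)).
  have [/= Cge Cnear] := CP (k.*2, start M r t k.*2).
  rewrite x_even ?odd_double//; split=> //; first by rewrite (leq_trans nk)// -addnn leq_addr.
  apply: (weak_ball_triangle (k' := i.*2.+1)) (leqnn _) nuj _.
  apply: weak_ball_sym; move: Cnear; rewrite doubleK gk; apply: weak_ballS.
  by rewrite (leq_trans ik)// -addnn leq_addr.
- exact: rU.
- apply: (traces_transitive M_spec r0 t_start ztr) => O oO O0 n.
  have [i Oi] := qd_dense O oO O0; have [k nk gk] := gP i n.
  by exists k => //; rewrite gk.
move=> [nu Lnu /(_ nu erefl) nuV].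
have [k n tk|mu muA munu] := gap_mass_bound X_compact D_continuous D_dense M_spec r0 tau_ge0
  t_start t_long t_gap (A := A) ztr _ nuV.
  have kn : (n0 k <= n)%N by rewrite -(leq_pmul2l (ltn0Sn k)) (leq_trans (t_n0 k)).
  by split; apply: n0P => //; rewrite /x; case: ifP => _; try case: ifP => _;
    by [constructor 1|constructor 2|constructor 3|constructor 4].
by have := KL_far mu nu muA Lnu; rewrite ltNge munu.
Qed.
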